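(* Let $\Sigma\subseteq\mathbb{F}_n^+$ be an admissible set, let $\mathcal{H}$ be a Hilbert space and let $M:\Sigma\to\mathcal{H}$ be a map. Then there is a $*$-representation $\pi:C^*(S_1,\ldots,S_n)\to B(\mathcal{E})$ on a Hilbert space $\mathcal{E}\supset\mathcal{H}$ such that $$M(p(g_1,\ldots,g_n))=\pi(p(S_1,\ldots,S_n))\,M(g_0)$$ for every polynomial $p(g_1,\ldots,g_n)\in\mathbb{C}\Sigma$, if and only if $K_3=K_4$, where $K_3,K_4:\Lambda_\Sigma\times\Lambda_\Sigma\to\mathbb{C}$ are the kernels $$K_3((\alpha,\beta),(\sigma,\gamma)):=\langle M(\sigma\gamma),M(\alpha\beta)\rangle,$$ $$K_4((\alpha,\beta),(\sigma,\gamma)):=\begin{cases}\langle M((\sigma\backslash\alpha)\gamma),M(\beta)\rangle, & \alpha\le\sigma\\ \langle M(\gamma),M((\alpha\backslash\sigma)\beta)\rangle, & \sigma<\alpha\\ 0, & \text{otherwise.}\end{cases}$$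
   Context: Let $n\in\{1,2,\ldots\}$ or $n=\infty$. $\mathbb{F}_n^+$ is the free semigroup with generators $g_1,\ldots,g_n$ and neutral element $g_0$. Let $H_n$ be an $n$-dimensional complex Hilbert space with orthonormal basis $e_1,\ldots,e_n$, and $F^2(H_n)=\bigoplus_{k\ge0}H_n^{\otimes k}$ (with $H_n^{\otimes 0}=\mathbb{C}1$) the full Fock space. The left creation operators are $S_i\psi=e_i\otimes\psi$, $\psi\in F^2(H_n)$, and $C^*(S_1,\ldots,S_n)$ is the $C^*$-algebra they generate (the Cuntz-Toeplitz algebra). For operators $T_1,\ldots,T_n$, $T_\alpha:=T_{i_1}\cdots T_{i_k}$ if $\alpha=g_{i_1}\cdots g_{i_k}$, and $T_{g_0}:=I$. A set $\Sigma\subseteq\mathbb{F}_n^+$ is admissible if $\alpha\beta\in\Sigma$ implies $\beta\in\Sigma$ (so a nonempty admissible set contains $g_0$). $\mathbb{C}\Sigma$ is the set of finite sums $p=\sum_{\sigma\in\Sigma}a_\sigma\sigma$, $a_\sigma\in\mathbb{C}$; for such $p=p(g_1,\ldots,g_n)$ one puts $p(S_1,\ldots,S_n)=\sum a_\sigma S_\sigma$, and $M$ is extended linearly, $M(p)=\sum a_\sigma M(\sigma)$. In the displayed identity $\mathcal{H}$ is regarded as a subspace of $\mathcal{E}$. Inner products are linear in the first variable. $\Lambda_\Sigma:=\{(\alpha,\beta):\alpha,\beta\in\mathbb{F}_n^+,\ \alpha\beta\in\Sigma\}$. For $\sigma,\alpha\in\mathbb{F}_n^+$, $\sigma\le\alpha$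 means $\alpha=\sigma\tau$ for some $\tau\in\mathbb{F}_n^+$; then $\alpha\backslash\sigma:=\tau$; $\sigma<\alpha$ means moreover $\tau\ne g_0$. *)

(* Defs.v *)
From HB Require Import structures.
From mathcomp Require Import all_boot all_order all_algebra finmap.
From mathcomp Require Import complex.
From mathcomp Require Import all_classical all_reals topology normedtype.

Set Implicit Arguments.
Unset Strict Implicit.
Unset Printing Implicit Defensive.

Import Order.TTheory GRing.Theory Num.Theory.
Import numFieldNormedType.Exports.

Local Open Scope classical_set_scope.
Local Open Scope ring_scope.
Local Open Scope complex_scope.

(* The form is linear in its first variable and conjugate-linear in its
   second one. *)
HB.mixin Record isHilbert (R : realType) V of CompleteNormedModule R[i] V := {
  inner : {dot V for (@Num.conj R[i])};
  sqr_normE : forall x : V, `|x| ^+ 2 = inner x x }.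

#[short(type="hilbertType")]
HB.structure Definition Hilbert (R : realType) :=
  {V of isHilbert R V & CompleteNormedModule R[i] V}.

Section HilbertSpaces.
Variable R : realType.
Implicit Types H F E : hilbertType R.

Definition lspan H (X : set H) : set H :=
  [set y | exists k (a : 'I_k -> R[i]) (x : 'I_k -> H),
    (forall j, X (x j)) /\ y = \sum_j a j *: x j].

Definition total H (X : set H) : Prop := closure (lspan X) = setT.

Definition orthonormal_basis (I : choiceType) H (e : I -> H) : Prop :=
  (forall i j, inner (e i) (e j) = (i == j)%:R) /\ total (range e).

(* B(H): everywhere defined linear operators that are continuous, that is,
   bounded. *)
Definition bounded_op H : set (H -> H) := [set T | linear T /\ continuous T].

Definition adjoint H (T U : H -> H) : Prop :=
  forall x y, inner (T x) y = inner x (U y).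

(* The last clause is closedness for the operator norm: its inner inequality
   says that the operator norm of T - U is at most eps. *)
Record cstar_subalgebra H (A : set (H -> H)) : Prop := CStarSubalgebra {
  cstar_bounded : A `<=` bounded_op (H:=H);
  cstar_zero : A 0;
  cstar_linear : forall (a : R[i]) T U, A T -> A U -> A (a *: T + U);
  cstar_comp : forall T U, A T -> A U -> A (T \o U);
  cstar_adjoint : forall T U, A T -> bounded_op U -> adjoint T U -> A U;
  cstar_closed : forall T, bounded_op T ->
    (forall eps : R, 0 < eps ->
       exists2 U, A U & forall x, `|T x - U x| <= eps%:C * `|x|) -> A T }.

Definition cstar_generated (I : Type) H (S : I -> H -> H) : set (H -> H) :=
  smallest (@cstar_subalgebra H) (range S).

(* Only the restriction of pi to A matters: a map from A to B(E) is encoded as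
   a map on all functions H -> H. *)
Record star_representation H (A : set (H -> H)) E
    (pi : (H -> H) -> (E -> E)) : Prop := StarRepresentation {
  star_rep_bounded : forall T, A T -> bounded_op (pi T);
  star_rep_linear : forall (a : R[i]) T U, A T -> A U ->
    pi (a *: T + U) = a *: pi T + pi U;
  star_rep_comp : forall T U, A T -> A U -> pi (T \o U) = pi T \o pi U;
  star_rep_adjoint : forall T U, A T -> A U -> adjoint T U ->
    adjoint (pi T) (pi U) }.

(* F is the Hilbert direct sum over k of the Hilbert tensor powers of H, where
   [tens [:: x1; ...; xk]] is the elementary tensor x1 (x) ... (x) xk in the
   k-th summand, and [tens [::]] is the vacuum vector 1. These conditions
   determine the pair (F, tens) up to a unique unitary isomorphism. *)
Record full_fock_space H F (tens : seq H -> F) : Prop := FullFockSpace {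
  fock_multilinear : forall s t, linear (fun x => tens (s ++ x :: t));
  fock_inner : forall s t, inner (tens s) (tens t) =
    if size s == size t then \prod_(p <- zip s t) inner p.1 p.2 else 0;
  fock_total : total (range tens) }.

(* T psi = x (x) psi; a bounded operator is determined by its values on the
   elementary tensors. *)
Definition left_creation H F (tens : seq H -> F) (x : H) (T : F -> F) : Prop :=
  bounded_op T /\ forall s, T (tens s) = tens (x :: s).

End HilbertSpaces.

(* The generators g_1, ..., g_n; [None] stands for n = infinity. *)
Definition gen (n : option nat) : countType :=
  if n is Some m then 'I_m else nat.

(* The free semigroup F_n^+: the product is [++], the neutral element g_0 is
   [[::]], and s <= a is [prefix s a]. *)
Notation word n := (seq (gen n)).

Section Words.
Variables (R : realType) (n : option nat).
Implicit Types (Sigma : set (word n)) (H : hilbertType R).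

Definition admissible Sigma : Prop :=
  forall a b : word n, Sigma (a ++ b) -> Sigma b.

Definition Lambda Sigma : set (word n * word n) := [set x | Sigma (x.1 ++ x.2)].

(* [a \\ s] is the t such that a = s ++ t, meaningful when [prefix s a]. *)
Definition word_diff (a s : word n) : word n := drop (size s) a.

Definition word_prod H (S : gen n -> H -> H) (w : word n) : H -> H :=
  foldr (fun i T => S i \o T) id w.

(* Polynomials are finitely supported functions on words. *)
Definition polynomials Sigma : set {fsfun word n -> R[i] with 0} :=
  [set p | forall w, w \in finsupp p -> Sigma w].

Definition linear_extension (V : lmodType R[i]) (M : word n -> V)
    (p : {fsfun word n -> R[i] with 0}) : V :=
  \sum_(w <- finsupp p) p w *: M w.

(* A map M on Sigma is encoded as a map on all words. On pairs from
   [Lambda Sigma], with Sigma admissible, both kernels evaluate M on Sigma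
   only. *)
Definition K3 H (M : word n -> H) (x y : word n * word n) : R[i] :=
  let: (alpha, beta) := x in let: (sigma, gamma) := y in
  inner (M (sigma ++ gamma)) (M (alpha ++ beta)).

Definition K4 H (M : word n -> H) (x y : word n * word n) : R[i] :=
  let: (alpha, beta) := x in let: (sigma, gamma) := y in
  if prefix alpha sigma then
    inner (M (word_diff sigma alpha ++ gamma)) (M beta)
  else if prefix sigma alpha && (sigma != alpha) then
    inner (M gamma) (M (word_diff alpha sigma ++ beta))
  else 0.

End Words.

(* Main.v *)
From HB Require Import structures.
Require Import Defs.
From mathcomp Require Import all_boot all_order all_algebra finmap complex ring.
From mathcomp Require Import all_classical all_reals topology normedtype.

(* K3 = K4 on Lambda is equivalent to the Toeplitz relation
   <M(g_i w), M(g_j v)> = delta_ij <M(w), M(v)>, which any representation implies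
   because S_i^* S_j = delta_ij I.

   Conversely, the Toeplitz relation says that M(w) |-> M(g_i w) extends to
   partial isometries with mutually orthogonal ranges.  Restricted to finitely
   many words and generators, they are finite rank operators T_i on H.  Fejer
   means of the Poisson kernel of (T_i) give isometric maps K_k from H into
   F^2(H_n) (x) H with K_k T_i x - (S_i (x) 1) K_k x -> 0 for x = M(w).  Every
   bounded operator on the Fock space acts on an ultraproduct of such tensor
   products, where the K_k induce an isometry J with
   J M(g_i w) = pi(S_i) J M(w). *)

Set Implicit Arguments.
Unset Strict Implicit.
Unset Printing Implicit Defensive.

Import Order.TTheory GRing.Theory Num.Theory.
Import numFieldNormedType.Exports.

Local Open Scope classical_set_scope.
Local Open Scope complex_scope.
Local Open Scope ring_scope.

(** * Positive semidefinite forms *)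

(** Write [B_i] for the adjoint of [T_i] and [Q] for the sum of the [T_i B_i]. The plain Poisson
    kernel of [(T_i)] intertwines exactly, but it loses the limit of the sums of [|B_w x|^2] over
    the words [w] of length k, and it vanishes when [Q = 1]. The Fejer weights restore the norm; the
    price is an intertwining error that disappears only as k grows, so a limit space is needed. An
    ultraproduct serves because operators act on it index by index: [pi] is defined on all bounded
    operators of the Fock space at once, and nothing has to be extended from polynomials in the
    [S_i] to their norm closure. Truncation gives finite rank, hence explicit adjoints and a finite
    sum [Q] even for infinitely many generators; the omitted words and generators return in the
    limit. It also replaces the Hilbert tensor product by a finite sum of inner products in the Fock
    space. No finite-dimensional subspace contains every [x], so this subspace has to vary with the
    index too. *)

Lemma linear_at0 (K : pzRingType) (V W : lmodType K) (f : V -> W) :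
  linear f -> f 0 = 0.
Proof.
by move=> f_lin; have := f_lin (-1) 0 0; rewrite !scaleN1r oppr0 !addNr addr0.
Qed.

Lemma linear_atB (K : pzRingType) (V W : lmodType K) (f : V -> W) x y :
  linear f -> f (x - y) = f x - f y.
Proof. by move=> f_lin; rewrite addrC -scaleN1r f_lin scaleN1r addrC. Qed.

Lemma linear_atZ (K : pzRingType) (V W : lmodType K) (f : V -> W) a x :
  linear f -> f (a *: x) = a *: f x.
Proof. by move=> f_lin; rewrite -[a *: x]addr0 f_lin linear_at0 // addr0. Qed.

Record psd_form (C : numClosedFieldType) (X : lmodType C) (b : X -> X -> C) :
    Prop := PsdForm {
  psd_linear : forall a x y z, b (a *: x + y) z = a * b x z + b y z;
  psd_herm : forall x y, b y x = (b x y)^*;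
  psd_ge0 : forall x, 0 <= b x x }.

Section PsdForms.
Variables (C : numClosedFieldType) (X : lmodType C) (b : X -> X -> C).
Hypothesis b_psd : psd_form b.

Lemma psdDl x y z : b (x + y) z = b x z + b y z.
Proof. by rewrite -[x]scale1r (psd_linear b_psd) mul1r scale1r. Qed.

Lemma psd0l z : b 0 z = 0.
Proof. by apply: (addrI (b 0 z)); rewrite -psdDl !addr0. Qed.

Lemma psdZl a x z : b (a *: x) z = a * b x z.
Proof. by rewrite -[a *: x]addr0 (psd_linear b_psd) psd0l addr0. Qed.

Lemma psdNl x z : b (- x) z = - b x z.
Proof. by rewrite -scaleN1r psdZl mulN1r. Qed.

Lemma psdBl x y z : b (x - y) z = b x z - b y z.
Proof. by rewrite psdDl psdNl. Qed.

Lemma psdDr x y z : b z (x + y) = b z x + b z y.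
Proof. by rewrite !(psd_herm b_psd _ z) psdDl rmorphD. Qed.

Lemma psd0r z : b z 0 = 0.
Proof. by rewrite (psd_herm b_psd _ z) psd0l rmorph0. Qed.

Lemma psdZr a x z : b z (a *: x) = a^* * b z x.
Proof. by rewrite !(psd_herm b_psd _ z) psdZl rmorphM. Qed.

Lemma psdNr x z : b z (- x) = - b z x.
Proof. by rewrite !(psd_herm b_psd _ z) psdNl rmorphN. Qed.

Lemma psdBr x y z : b z (x - y) = b z x - b z y.
Proof. by rewrite psdDr psdNr. Qed.

Lemma psd_suml I (r : seq I) (F : I -> X) z :
  b (\sum_(i <- r) F i) z = \sum_(i <- r) b (F i) z.
Proof. by apply: (big_morph (b^~ z)) => [x y|]; [exact: psdDl|exact: psd0l]. Qed.

Lemma psd_sumr I (r : seq I) (F : I -> X) z :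
  b z (\sum_(i <- r) F i) = \sum_(i <- r) b z (F i).
Proof. by apply: (big_morph (b z)) => [x y|]; [exact: psdDr|exact: psd0r]. Qed.

Lemma psd_CauchySchwarz_sqr x y : `|b x y| ^+ 2 <= b x x * b y y.
Proof.
have key (s : C) : 0 <= s -> 0 <= b x x + s ^+ 2 * `|b x y| ^+ 2 * b y y
    - 2 * s * `|b x y| ^+ 2.
  move=> s0; have := psd_ge0 b_psd (x - (s * b x y) *: y).
  rewrite psdBl !psdBr !psdZl !psdZr (psd_herm b_psd x y) rmorphM /=.
  rewrite (conj_Creal (ger0_real s0)) normCK.
  by congr (0 <= _); ring.
have n0 : 0 <= `|b x y| ^+ 2 by rewrite exprn_ge0.
have [b0|b0] := eqVneq (b y y) 0; rewrite ?b0.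
  have [->|u0] := eqVneq (b x y) 0.
    by rewrite normr0 expr0n mulr0.
  have n1 : `|b x y| ^+ 2 != 0 by rewrite expf_neq0 // normr_eq0.
  (* For a null vector [y] the bound [key] is affine in [s]; at this [s] its right-hand side is
     [- (b x x + 2)], which is negative. *)
  have s0 : 0 <= (b x x + 1) / `|b x y| ^+ 2.
    by rewrite divr_ge0 // addr_ge0 ?ler01 ?(psd_ge0 b_psd).
  have := key _ s0; rewrite b0.
  have -> : b x x + ((b x x + 1) / `|b x y| ^+ 2) ^+ 2 * `|b x y| ^+ 2 * 0
    - 2 * ((b x x + 1) / `|b x y| ^+ 2) * `|b x y| ^+ 2 = - (b x x + 2).
    by field; rewrite normr_eq0.
  by rewrite oppr_ge0 lt_geF // ltr_wpDl ?(psd_ge0 b_psd) ?ltr0n.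
have b1 : 0 < b y y by rewrite lt_def b0 (psd_ge0 b_psd).
have s0 : 0 <= (b y y)^-1 by rewrite invr_ge0 ltW.
have := mulr_ge0 (ltW b1) (key _ s0); rewrite -[(_ <= b x x * _)%R]subr_ge0.
suff -> : b y y * (b x x + (b y y)^-1 ^+ 2 * `|b x y| ^+ 2 * b y y -
  2 * (b y y)^-1 * `|b x y| ^+ 2) = b x x * b y y - `|b x y| ^+ 2 by [].
by field.
Qed.

Definition psd_norm x := sqrtC (b x x).

Lemma psd_norm_ge0 x : 0 <= psd_norm x.
Proof. by rewrite sqrtC_ge0 (psd_ge0 b_psd). Qed.

Lemma sqr_psd_norm x : psd_norm x ^+ 2 = b x x.
Proof. exact: sqrtCK. Qed.

Lemma psd_CauchySchwarz x y : `|b x y| <= psd_norm x * psd_norm y.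
Proof.
rewrite -(@ler_pXn2r _ 2) ?nnegrE ?mulr_ge0 ?psd_norm_ge0 //.
by rewrite exprMn !sqr_psd_norm psd_CauchySchwarz_sqr.
Qed.

Lemma psd_norm_triangle x y : psd_norm (x + y) <= psd_norm x + psd_norm y.
Proof.
rewrite -(@ler_pXn2r _ 2) ?nnegrE ?addr_ge0 ?psd_norm_ge0 //.
rewrite sqrrD !sqr_psd_norm psdDl !psdDr (psd_herm b_psd x y).
rewrite -subr_ge0; set u := b x y.
have -> : b x x + psd_norm x * psd_norm y *+ 2 + b y y -
  (b x x + u + (u^* + b y y)) = psd_norm x * psd_norm y *+ 2 - (u + u^*) by ring.
rewrite subr_ge0 (le_trans (real_ler_norm _)) //.
  by rewrite CrealE rmorphD /= conjCK addrC.
rewrite (le_trans (ler_normD _ _)) // norm_conjC -mulr2n lerMn2r.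
exact: psd_CauchySchwarz.
Qed.

Lemma psd_normZ a x : psd_norm (a *: x) = `|a| * psd_norm x.
Proof.
by rewrite /psd_norm psdZl psdZr mulrA -normCK sqrtCM ?nnegrE ?exprn_ge0
  ?(psd_ge0 b_psd) // sqrCK.
Qed.

Lemma psd_norm0 : psd_norm 0 = 0.
Proof. by rewrite /psd_norm psd0l sqrtC0. Qed.

Lemma psd_norm_sum (u : nat -> X) m n : (m <= n)%N ->
  psd_norm (u n - u m) <= \sum_(m <= i < n) psd_norm (u i.+1 - u i).
Proof.
move=> mn; rewrite -(telescope_sumr _ mn).
elim: n mn => [|n IH] mn; first by rewrite !big_geq // psd_norm0.
have [mn'|] := ltnP m n.+1; last by move=> h; rewrite !big_geq // psd_norm0.
rewrite !big_nat_recr //= (le_trans (psd_norm_triangle _ _)) // lerD2r.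
exact: IH.
Qed.

End PsdForms.

Lemma inner_psd (R : realType) (H : hilbertType R) : psd_form (@inner R H).
Proof.
split=> [a x y z|x y|x]; first by rewrite linearPl.
- by rewrite hermC /= expr0 mul1r.
- exact: dnorm_ge0.
Qed.

Lemma inner_norm (R : realType) (H : hilbertType R) (x : H) :
  psd_norm inner x = `|x|.
Proof. by rewrite /psd_norm -sqr_normE sqrCK. Qed.

(** * The Hilbert space of a complete form *)

Lemma sum_geometric2_le (C : numFieldType) (k m : nat) :
  \sum_(k <= j < m) 2 ^- j <= 2 * 2 ^- k :> C.
Proof.
have [km|mk] := leqP k m; last first.
  by rewrite big_geq ?(ltnW mk) // mulr_ge0 // invr_ge0 exprn_ge0.
have -> : \sum_(k <= j < m) 2 ^- j = 2 * 2 ^- k - 2 * 2 ^- m :> C.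
  elim: m km => [|m IH]; first by rewrite leqn0 => /eqP->; rewrite big_geq ?subrr.
  rewrite leq_eqVlt => /predU1P[<-|km]; first by rewrite big_geq ?subrr.
  rewrite big_nat_recr //= IH // exprS invfM; field.
  by rewrite !expf_neq0 ?pnatr_eq0.
by rewrite gerBl mulr_ge0 // invr_ge0 exprn_ge0.
Qed.

Lemma complex_archi (R : realType) (e : R[i]) :
  0 < e -> exists N, forall n, (N <= n)%N -> 2 ^- n < e.
Proof.
case: e => a c; rewrite ltcE /= => /andP[/eqP -> a0].
have [N _ NP] := near_infty_natSinv_expn_lt (interval_inference.PosNum a0).
exists N => n /NP /=; rewrite -ltcR; apply: le_lt_trans.
by rewrite div1r fmorphV rmorphXn rmorph_nat.
Qed.

(** Completeness is tested on rapidly converging sequences, with an explicit rate. Null vectors are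
    allowed, so limits need not be unique. The constant 4 is what the ultraproduct yields: a factor
    2 for passing to single indices and a factor 2 for the geometric series. *)
Definition psd_complete (C : numClosedFieldType) (X : lmodType C)
    (b : X -> X -> C) : Prop :=
  forall u : nat -> X, (forall n, psd_norm b (u n.+1 - u n) <= 2 ^- n) ->
  exists x, forall n, psd_norm b (x - u n) <= 4 * 2 ^- n.

Record complete_form (C : numClosedFieldType) (X : lmodType C) := CompleteForm {
  form_val :> X -> X -> C;
  form_psd : psd_form form_val;
  form_complete : psd_complete form_val }.

Section HilbertQuotient.
Variables (R : realType) (X : lmodType R[i]) (b : complete_form X).

Let b_psd := form_psd b.

(* The quotient by the null vectors is realized as the set of the functionals
   [b x]. *)
Definition quotient_pred : {pred X -> R[i]^o} :=
  [pred f | `[< exists x, f = b x >]].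

Fact quotient_pred_closed : subsemimod_closed quotient_pred.
Proof.
split; [split|].
- by apply/asboolP; exists 0; apply/funext => z; rewrite (psd0l b_psd).
- move=> _ _ /asboolP[x ->] /asboolP[y ->]; apply/asboolP; exists (x + y).
  by apply/funext => z; rewrite (psdDl b_psd).
- move=> a _ /asboolP[x ->]; apply/asboolP; exists (a *: x).
  by apply/funext => z; rewrite (psdZl b_psd).
Qed.

Record hquotient := HQuotient {
  hq_val :> X -> R[i]^o; hq_valP : hq_val \in quotient_pred }.

HB.instance Definition _ := [isSub for hq_val].
HB.instance Definition _ := [Choice of hquotient by <:].
HB.instance Definition _ := GRing.SubChoice_isSubLmodule.Build
  R[i] (X -> R[i]^o) quotient_pred hquotient quotient_pred_closed.

Fact hq_proj_subproof x : (b x : X -> R[i]^o) \in quotient_pred.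
Proof. by apply/asboolP; exists x. Qed.

Definition hq_proj x : hquotient := HQuotient (hq_proj_subproof x).

Lemma hq_proj_linear : linear hq_proj.
Proof.
move=> a x y; apply: val_inj => /=.
by apply/funext => z; rewrite (psd_linear b_psd).
Qed.

Lemma hq_surj f : exists x, hq_proj x = f.
Proof.
case: f => f fP; have /asboolP[x fE] := fP.
by exists x; apply: val_inj; rewrite /= fE.
Qed.

Definition hq_rep f : X := projT1 (cid (hq_surj f)).

Lemma hq_repK : cancel hq_rep hq_proj.
Proof. by move=> f; rewrite /hq_rep; case: cid. Qed.

Definition hq_form (f g : hquotient) : R[i] := f (hq_rep g).

Lemma hq_formE x y : hq_form (hq_proj x) (hq_proj y) = b x y.
Proof.
rewrite /hq_form /= (psd_herm b_psd _ x) (psd_herm b_psd y x); congr (_ ^*).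
have /(congr1 (fun f : hquotient => f x)) := hq_repK (hq_proj y).
by [].
Qed.

Lemma hq_psd : psd_form hq_form.
Proof.
split.
- move=> a f g h; rewrite -(hq_repK f) -(hq_repK g) -(hq_repK h).
  by rewrite -hq_proj_linear !hq_formE (psd_linear b_psd).
- by move=> f g; rewrite -(hq_repK f) -(hq_repK g) !hq_formE (psd_herm b_psd).
- by move=> f; rewrite -(hq_repK f) !hq_formE (psd_ge0 b_psd).
Qed.

Lemma hq_form_eq0 f : hq_form f f = 0 -> f = 0.
Proof.
rewrite -(hq_repK f) hq_formE => f0; apply: val_inj; apply/funext => z /=.
apply/eqP; rewrite -normr_eq0 -sqrf_eq0 eq_le exprn_ge0 // andbT.
by rewrite (le_trans (psd_CauchySchwarz_sqr b_psd _ _)) // f0 mul0r.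
Qed.

Lemma hq_norm_eq0 f : psd_norm hq_form f = 0 -> f = 0.
Proof.
by move=> f0; apply: hq_form_eq0; rewrite -(sqr_psd_norm hq_form) f0 expr0n.
Qed.

HB.instance Definition _ := Lmodule_isNormed.Build R[i] hquotient
  (psd_norm_triangle hq_psd) (psd_normZ hq_psd) hq_norm_eq0.

Lemma hq_normE f : `|f| = psd_norm hq_form f. Proof. by []. Qed.

Lemma hq_norm_proj x : `|hq_proj x| = psd_norm b x.
Proof. by rewrite hq_normE /psd_norm hq_formE. Qed.

Lemma hq_projB x y : hq_proj (x - y) = hq_proj x - hq_proj y.
Proof.
by rewrite addrC -scaleN1r hq_proj_linear scaleN1r addrC.
Qed.

Lemma hq_cauchy_cvg (F : set_system hquotient) :
  ProperFilter F -> cauchy F -> cvg F.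
Proof.
move=> FF Fc.
(* With these radii consecutive centres are [2 ^- n]-close, because two members of [F] share a
   point. A limit of the centres is then a limit of [F]. *)
have e0 n : (0 : R[i]) < 2 ^- n.+2 by rewrite invr_gt0 exprn_gt0.
have /choice[f fP] n : exists f, F [set g | `|f - g| < 2 ^- n.+2 :> R[i]].
  have /cauchyP/(_ _ (e0 n))[f] := Fc.
  by rewrite -ball_normE; exists f.
have dist n g : `|f n - g| < 2 ^- n.+2 -> `|f n.+1 - g| < 2 ^- n.+3 ->
    `|f n.+1 - f n| <= 2 ^- n.
  move=> fg fg'.
  rewrite -(subrK g (f n.+1)) -addrA (le_trans (ler_normD _ _)) //.
  rewrite [ `|g - _|]distrC (le_trans (lerD (ltW fg') (ltW fg))) //.
  have -> : 2 ^- n = 2 ^- n.+3 + 2 ^- n.+2 + 5 * 2 ^- n.+3 :> R[i].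
    by rewrite !exprS !invfM; field; rewrite expf_neq0 ?pnatr_eq0.
  by rewrite lerDl mulr_ge0 // invr_ge0 exprn_ge0.
have [x xP] : exists x, forall n, `|hq_proj x - f n| <= 4 * 2 ^- n.
  have [|x xP] := @form_complete _ _ b (fun n => hq_rep (f n)).
    move=> n.
    have [g [/= fg fg']] := filter_ex (filterI (fP n) (fP n.+1)).
    by rewrite -hq_norm_proj hq_projB !hq_repK (dist n g).
  by exists x => n; rewrite -(hq_repK (f n)) -hq_projB hq_norm_proj.
apply/cvg_ex; exists (hq_proj x); apply/fcvgrPdist_lt => e eP.
have [N NP] := complex_archi (divr_gt0 eP (ltr0n _ 8)).
apply: filterS (fP N) => g /= fg.
rewrite -(subrK (f N) (hq_proj x)) -addrA (le_lt_trans (ler_normD _ _)) //.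
rewrite (le_lt_trans (lerD (xP N) (ltW fg))) //.
apply: le_lt_trans (_ : 8 * 2 ^- N < _); last first.
  by rewrite mulrC -ltr_pdivlMr ?ltr0n // NP.
have -> : 8 * 2 ^- N = 4 * 2 ^- N + 2 ^- N.+2 + 15 * 2 ^- N.+2 :> R[i].
  by rewrite !exprS !invfM; field; rewrite expf_neq0 ?pnatr_eq0.
by rewrite lerDl mulr_ge0 // invr_ge0 exprn_ge0.
Qed.

HB.instance Definition _ :=
  Uniform_isComplete.Build hquotient hq_cauchy_cvg.

Fact hq_form_bilinear : bilinear_for
  (GRing.Scale.Law.clone _ _ *%R _)
  (GRing.Scale.Law.clone _ _ (Num.conj \; *%R) _) hq_form.
Proof.
split=> [g a f h|f a g h]; first exact: (psd_linear hq_psd).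
apply: etrans (psdDr hq_psd _ _ _) _; congr (_ + _); exact: (psdZr hq_psd).
Qed.

HB.instance Definition _ := bilinear_isBilinear.Build R[i]
  hquotient hquotient R[i] _ _ hq_form hq_form_bilinear.

Fact hq_form_hermitian f g :
  hq_form f g = (-1) ^+ false * Num.conj (hq_form g f).
Proof. by rewrite mul1r (psd_herm hq_psd). Qed.

HB.instance Definition _ := isHermitianSesquilinear.Build R[i]
  hquotient false Num.conj hq_form hq_form_hermitian.

Fact hq_form_pos f : f != 0 -> 0 < hq_form f f.
Proof.
move=> f0; rewrite lt_def (psd_ge0 hq_psd) andbT.
by apply: contra f0 => /eqP/hq_form_eq0 ->.
Qed.

HB.instance Definition _ := isDotProduct.Build R[i] hquotient hq_form hq_form_pos.

HB.instance Definition _ := isHilbert.Build R hquotient (sqr_psd_norm hq_form).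

End HilbertQuotient.

Lemma complete_form_hilbert (R : realType) (X : lmodType R[i]) (b : X -> X -> R[i]) :
  psd_form b -> psd_complete b ->
  exists (E : hilbertType R) (q : {linear X -> E}),
    (forall f, exists x, q x = f) /\ forall x y, inner (q x) (q y) = b x y.
Proof.
move=> b_psd b_complete; pose c := CompleteForm b_psd b_complete.
pose q := GRing.isLinear.Build _ _ _ _ (hq_proj c) (hq_proj_linear c).
exists (hquotient c : hilbertType R).
exists (HB.pack (hq_proj c) q : {linear X -> hquotient c}).
split; [exact: hq_surj | exact: hq_formE].
Qed.

(** * Ultralimits and ultraproducts *)

Section UltraLimits.
Variables (R : realType) (D : Type) (U : set_system D).
Hypothesis U_ultra : UltraFilter U.
Implicit Types (f g : D -> R[i]^o).

Lemma ultra_compact_cvg (T : topologicalType) (K : set T) (h : D -> T) :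
  compact K -> (forall d, K (h d)) -> exists l : T, h @ U --> l.
Proof.
move=> Kc Kh.
have hUK : (h @ U) K by exact: (filterE _ Kh).
have [l [_ lh]] := Kc (h @ U) _ hUK.
exists l => B Bl; have [//|hB] := in_ultra_setVsetC (h @^-1` B) U_ultra.
by have [x []] := lh (~` B) B hB Bl.
Qed.

Lemma cvg_real_complex (g : D -> R) (l : R) :
  g @ U --> l -> (fun d => (g d)%:C : R[i]^o) @ U --> (l%:C : R[i]^o).
Proof.
move=> /cvgrPdist_lt gl; apply/cvgrPdist_lt => -[e c].
rewrite ltcE /= => /andP[/eqP -> e0].
apply: filterS (gl _ e0) => d; rewrite -rmorphB normc_def /= expr0n addr0.
by rewrite sqrtr_sqr ltcR.
Qed.

Lemma ultra_bounded_cvg f (M : R[i]) : (forall d, `|f d| <= M) ->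
  exists l : R[i]^o, f @ U --> l.
Proof.
move=> fM.
have cmp : compact `[- complex.Re M, complex.Re M]%classic by exact: segment_compact.
have [|r rP] := @ultra_compact_cvg _ _ (fun d => complex.Re (f d)) cmp.
  move=> d; have := fM d; case: (f d) => a b; rewrite normc_def lecE /=.
  move=> /andP[_] h; rewrite in_itv /= -ler_norml; apply: le_trans h.
  by rewrite -sqrtr_sqr ler_wsqrtr // lerDl sqr_ge0.
have [|s sP] := @ultra_compact_cvg _ _ (fun d => complex.Im (f d)) cmp.
  move=> d; have := fM d; case: (f d) => a b; rewrite normc_def lecE /=.
  move=> /andP[_] h; rewrite in_itv /= -ler_norml; apply: le_trans h.
  by rewrite -sqrtr_sqr ler_wsqrtr // lerDr sqr_ge0.
exists (r%:C + 'i%C * s%:C).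
have -> : f = (fun d => (complex.Re (f d))%:C + 'i%C * (complex.Im (f d))%:C).
  by apply/funext => d; rewrite -complexE.
apply: cvgD; first exact: cvg_real_complex.
apply: cvgM; [exact: cvg_cst|exact: cvg_real_complex].
Qed.

Lemma ultra_cvg f (M : R[i]) : (\forall d \near U, `|f d| <= M) ->
  exists l : R[i]^o, f @ U --> l.
Proof.
(* Off the large set where the bound holds, [f] is replaced by 0. There [M] is not known to be
   nonnegative, hence its norm as the bound. *)
move=> fM; pose g d : R[i]^o := if `|f d| <= M then f d else 0.
have [|l gl] := @ultra_bounded_cvg g `|M|.
  move=> d; rewrite /g; case: ifP => [fdM|_]; last by rewrite normr0.
  by rewrite (le_trans fdM) // real_ler_norm // ger0_real // (le_trans _ fdM).
exists l; apply: cvg_trans gl; apply: near_eq_cvg.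
by apply: filterS fM => d; rewrite /g => ->.
Qed.

Lemma ultra_cvg_unique f (l m : R[i]) :
  f @ U --> (l : R[i]^o) -> f @ U --> (m : R[i]^o) -> l = m.
Proof. by move=> fl fm; exact: (cvg_unique _ fl fm). Qed.

(** Where [f] is nonnegative it equals its norm, so the limit [l] equals the norm of [l]. *)
Lemma ultra_cvg_ge0 f (l : R[i]^o) : f @ U --> l ->
  (\forall d \near U, 0 <= f d) -> (0 : R[i]) <= l.
Proof.
move=> fl f0.
have fn : (fun d => `|f d| : R[i]^o) @ U --> (`|l| : R[i]^o) by exact: cvg_norm.
have fn' : (fun d => `|f d| : R[i]^o) @ U --> l.
  apply: cvg_trans fl; apply: near_eq_cvg.
  by apply: filterS f0 => d /ger0_norm ->.
by rewrite (cvg_unique _ fn' fn).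
Qed.

Lemma ultra_cvg_conj f (l : R[i]^o) : f @ U --> l ->
  (fun d => Num.conj (f d : R[i]) : R[i]^o) @ U --> (Num.conj (l : R[i]) : R[i]^o).
Proof.
move=> /cvgrPdist_lt fl; apply/cvgrPdist_lt => e /fl.
by apply: filterS => d; rewrite -rmorphB norm_conjC.
Qed.

End UltraLimits.

Section Ultraproduct.
Variables (R : realType) (D : choiceType) (U : set_system D) (ht : D -> nat).
Hypothesis U_ultra : UltraFilter U.
Hypothesis U_ht : forall n, U [set d | (n <= ht d)%N].
Variables (Y : lmodType R[i]) (p : D -> Y -> Y -> R[i]).
Hypothesis p_psd : forall d, psd_form (p d).

(** A bound on a large set is all that is available: the estimates of the single stages hold only at
    indices whose finite family expands the vector at hand. *)
Definition ubounded (x : D -> Y) : Prop :=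
  exists M, \forall d \near U, psd_norm (p d) (x d) <= M.

Lemma ubounded_linear a x y :
  ubounded x -> ubounded y -> ubounded (a *: x + y).
Proof.
move=> [M xM] [N yN]; exists (`|a| * M + N).
apply: filterS (filterI xM yN) => d [/= {}xM {}yN].
rewrite (le_trans (psd_norm_triangle (p_psd d) _ _)) // lerD //.
by rewrite (psd_normZ (p_psd d)) ler_wpM2l.
Qed.

Lemma ubounded0 : ubounded 0.
Proof. by exists 0; apply: filterE => d; rewrite (psd_norm0 (p_psd d)). Qed.

Definition ubounded_pred : {pred D -> Y} := [pred x | `[< ubounded x >]].

Fact ubounded_closed : subsemimod_closed ubounded_pred.
Proof.
split; [split|].
- by apply/asboolP; exact: ubounded0.
- move=> x y /asboolP xb /asboolP yb; apply/asboolP.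
  by rewrite -[x]scale1r; exact: ubounded_linear.
- move=> a x /asboolP xb; apply/asboolP.
  by rewrite -[a *: x]addr0; apply: ubounded_linear ubounded0.
Qed.

Record ufamily := UFamily { uf_val :> D -> Y; uf_valP : uf_val \in ubounded_pred }.

HB.instance Definition _ := [isSub for uf_val].
HB.instance Definition _ := [Choice of ufamily by <:].
HB.instance Definition _ := GRing.SubChoice_isSubLmodule.Build
  R[i] (D -> Y) ubounded_pred ufamily ubounded_closed.

Lemma ufamily_cvg (x y : ufamily) :
  exists l : R[i]^o, (fun d => p d (x d) (y d) : R[i]^o) @ U --> l.
Proof.
have /asboolP[M xM] := uf_valP x; have /asboolP[N yN] := uf_valP y.
apply: (@ultra_cvg _ _ _ _ _ (M * N)).
apply: filterS (filterI xM yN) => d [/= {}xM {}yN].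
rewrite (le_trans (psd_CauchySchwarz (p_psd d) _ _)) //.
by rewrite ler_pM ?psd_norm_ge0.
Qed.

Definition uform (x y : ufamily) : R[i] := projT1 (cid (ufamily_cvg x y)).

Lemma uformP (x y : ufamily) :
  (fun d => p d (x d) (y d) : R[i]^o) @ U --> (uform x y : R[i]^o).
Proof. by rewrite /uform; case: cid. Qed.

Lemma uform_psd : psd_form uform.
Proof.
split=> [a x y z|x y|x].
- apply: (ultra_cvg_unique _ (@uformP _ _)).
  have -> : (fun d => p d ((a *: x + y) d) (z d)) =
      (fun d => a * p d (x d) (z d) + p d (y d) (z d)).
    by apply/funext => d; rewrite -(psd_linear (p_psd d)).
  apply: cvgD; last exact: uformP.
  by apply: cvgM; [exact: cvg_cst|exact: uformP].
- apply: (ultra_cvg_unique _ (@uformP _ _)).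
  have -> : (fun d => p d (y d) (x d)) = (fun d => (p d (x d) (y d))^*).
    by apply/funext => d; rewrite -(psd_herm (p_psd d)).
  exact: (ultra_cvg_conj _ (@uformP x y)).
- apply: (ultra_cvg_ge0 _ (@uformP x x)).
  by apply: filterE => d; exact: psd_ge0.
Qed.

(** A bound on the limit passes to the indices only after being strictly relaxed. This costs a
    factor 2 in the completeness proof. *)
Lemma uform_le_near (x : ufamily) (M N : R[i]) : M < N ->
  psd_norm uform x <= M -> \forall d \near U, psd_norm (p d) (x d) <= N.
Proof.
move=> MN xM; have x0 := psd_norm_ge0 uform_psd x.
have M0 := le_trans x0 xM; have N0 := ltW (le_lt_trans M0 MN).
have e0 : 0 < N ^+ 2 - psd_norm uform x ^+ 2.
  by rewrite subr_gt0 ltrXn2r // (le_lt_trans xM).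
have /cvgrPdist_lt/(_ _ e0) := @uformP x x.
apply: filterS => d; rewrite sqr_psd_norm distrC => dN.
rewrite -(@ler_pXn2r _ 2) ?nnegrE ?psd_norm_ge0 // sqr_psd_norm.
rewrite -(subrK (uform x x) (p d _ _)) -lerBrDr.
rewrite (le_trans _ (ltW dN)) // real_ler_norm // rpredB //.
  by rewrite ger0_real // (psd_ge0 (p_psd d)).
by rewrite ger0_real // (psd_ge0 uform_psd).
Qed.

Lemma uform_near_le (x : ufamily) (M : R[i]) : 0 <= M ->
  (\forall d \near U, psd_norm (p d) (x d) <= M) -> psd_norm uform x <= M.
Proof.
move=> M0 xM; rewrite -(@ler_pXn2r _ 2) ?nnegrE ?(psd_norm_ge0 uform_psd) //.
rewrite sqr_psd_norm -subr_ge0.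
have h : (fun d => M ^+ 2 - p d (x d) (x d) : R[i]^o) @ U -->
    (M ^+ 2 - uform x x : R[i]^o).
  by apply: cvgB; [exact: cvg_cst|exact: uformP].
apply: ultra_cvg_ge0 h _; apply: filterS xM => d xM.
by rewrite subr_ge0 -sqr_psd_norm ler_pXn2r ?nnegrE ?psd_norm_ge0.
Qed.

(* On the set where the first [k] increments of [u] are small, the diagonal
   [d |-> u (m d) d] stays close to [u k]; each [d] uses the largest index
   [m d] that is allowed for it. *)
Lemma uform_complete : psd_complete uform.
Proof.
move=> u u_le.
pose A j d := psd_norm (p d) (u j.+1 d - u j d) <= 2 * 2 ^- j.
have UA j : U [set d | A j d].
  apply: (uform_le_near _ (u_le j)).
  by rewrite ltr_pMl ?invr_gt0 ?exprn_gt0 // ltr1n.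
(* Cutting the search at [ht d] keeps [m d] finite even if every increment is small at [d]. Since
   [ht] tends to infinity along [U], the cut does no harm near [U]; this is where countable
   incompleteness of the ultrafilter enters. *)
pose m d := find (fun j => ~~ A j d) (iota 0 (ht d)).
have mA d j : (j < m d)%N -> A j d.
  move=> jm; have := before_find 0%N jm; rewrite nth_iota ?add0n.
    by move=> /negbFE.
  by rewrite -[X in (_ < X)%N](size_iota 0) (leq_trans jm) ?find_size.
have km d k : (k <= ht d)%N -> (forall j, (j < k)%N -> A j d) -> (k <= m d)%N.
  move=> kh kA; rewrite leqNgt; apply/negP => mk.
  have : has (fun j => ~~ A j d) (iota 0 (ht d)).
    by rewrite has_find size_iota (leq_trans mk).
  move=> /(nth_find 0%N) /=; rewrite -/(m d) nth_iota ?(leq_trans mk) //.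
  by rewrite add0n kA.
pose y d := u (m d) d.
have y_le d k : (k <= m d)%N -> psd_norm (p d) (y d - u k d) <= 4 * 2 ^- k.
  move=> kmd; apply: le_trans (psd_norm_sum (p_psd d) (fun j => u j d) kmd) _.
  have -> : 4 * 2 ^- k = 2 * (2 * 2 ^- k) :> R[i] by ring.
  apply: le_trans (ler_wpM2l _ (sum_geometric2_le _ k (m d))) => //.
  rewrite mulr_sumr big_nat_cond [leRHS]big_nat_cond; apply: ler_sum => j.
  by rewrite andbT => /andP[_ /mA].
have yb : y \in ubounded_pred.
  apply/asboolP; have /asboolP[M uM] := uf_valP (u 0%N).
  exists (4 * 2 ^- 0 + M); apply: filterS uM => d uM.
  rewrite -(subrK (u 0%N d) (y d)) (le_trans (psd_norm_triangle (p_psd d) _ _)) //.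
  by rewrite lerD ?y_le.
exists (UFamily yb) => k; apply: uform_near_le.
  by rewrite mulr_ge0 // invr_ge0 exprn_ge0.
have Uk : U [set d | forall j, (j < k)%N -> A j d].
  elim: k => [|k IH]; first exact: filterE.
  apply: filterS (filterI IH (UA k)) => d [/= kA Ak] j.
  by rewrite ltnS leq_eqVlt => /predU1P[->|/kA].
apply: filterS (filterI Uk (U_ht k)) => d [/= kA kh].
by apply: y_le; exact: km.
Qed.

Lemma ultraproduct : exists (E : hilbertType R) (q : (D -> Y) -> E),
  [/\ forall a x y, ubounded x -> ubounded y -> q (a *: x + y) = a *: q x + q y,
      forall x y, ubounded x -> ubounded y ->
        (fun d => p d (x d) (y d) : R[i]^o) @ U --> (inner (q x) (q y) : R[i]^o) &
      forall f, exists2 x, ubounded x & q x = f].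
Proof.
have [E [Q [Qsurj QE]]] := complete_form_hilbert uform_psd uform_complete.
(* Unbounded families are replaced by 0, which makes [q] total; the three clauses concern bounded
   families. *)
pose q x := Q (insubd 0 x); exists E, q.
have insE x : ubounded x -> val (insubd (0 : ufamily) x) = x.
  by move=> xb; rewrite insubdK //; apply/asboolP.
split=> [a x y xb yb|x y xb yb|f].
- rewrite /q -linearP; congr (Q _); apply: val_inj.
  by rewrite insE; [rewrite /= !insE|exact: ubounded_linear].
- rewrite QE; have := @uformP (insubd 0 x) (insubd 0 y).
  by rewrite -!/(val _) !insE.
- have [x <-] := Qsurj f; exists (val x); first exact/asboolP/(uf_valP x).
  by rewrite /q valKd.
Qed.

End Ultraproduct.

(** * The Riesz representation theorem *)

Section Riesz.
Variables (R : realType) (H : hilbertType R).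
Implicit Types (x y z : H) (T : H -> H).
Let psd := inner_psd H.

Lemma sqr_normr x : inner x x = `|x| ^+ 2.
Proof. by rewrite sqr_normE. Qed.

Lemma inner_CauchySchwarz x y : `|inner x y| <= `|x| * `|y|.
Proof. by rewrite -!inner_norm; exact: psd_CauchySchwarz. Qed.

Lemma hilbert_complete (u : nat -> H) :
  (forall n, `|u n.+1 - u n| <= 2 ^- n) ->
  exists x, forall n, `|x - u n| <= 4 * 2 ^- n.
Proof.
move=> u_le.
have uB k n : (k <= n)%N -> `|u n - u k| <= 2 * 2 ^- k.
  move=> kn; rewrite -inner_norm; apply: le_trans (psd_norm_sum psd u kn) _.
  apply: le_trans (sum_geometric2_le _ k n).
  by apply: ler_sum => j _; rewrite inner_norm.
have uc : cvg (u @ \oo).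
  apply: cauchy_cvg; apply/cauchyP => e e0.
  have [N NP] := complex_archi (divr_gt0 e0 (ltr0n _ 2)).
  exists (u N); rewrite -ball_normE; exists N => // n /= Nn.
  rewrite distrC (le_lt_trans (uB _ _ Nn)) //.
  by rewrite mulrC -ltr_pdivlMr // NP.
have [x ux] := (iffLR (cvg_ex _)) uc.
exists x => n; have e0 : (0 : R[i]) < 2 * 2 ^- n.
  by rewrite mulr_gt0 // invr_gt0 exprn_gt0.
have /cvgrPdist_lt/(_ _ e0)[N _ NP] := ux.
have h := NP (maxn N n) (leq_maxl _ _).
rewrite -(subrK (u (maxn N n)) x) -addrA (le_trans (ler_normD _ _)) //.
have -> : 4 * 2 ^- n = 2 * 2 ^- n + 2 * 2 ^- n :> R[i] by ring.
by rewrite lerD ?(ltW h) // uB ?leq_maxr.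
Qed.

Lemma le_geometric2_eq0 (V : normedModType R[i]) (v : V) (K : R[i]) :
  0 <= K -> (forall n, `|v| <= K * 2 ^- n) -> v = 0.
Proof.
move=> K0 vK; apply/eqP; rewrite -normr_eq0; apply/negPn/negP => v0.
have v1 : 0 < `|v| by rewrite lt_def v0 normr_ge0.
have K1 : 0 < K + 1 by rewrite ltr_wpDl.
have [N /(_ N (leqnn _))] := complex_archi (divr_gt0 v1 K1).
rewrite ltr_pdivlMr // => h.
have := lt_le_trans h (vK N); rewrite [K * _]mulrC.
by rewrite ltr_pM2l ?invr_gt0 ?exprn_gt0 // gtrDl ltr10.
Qed.

(* The representing vector minimizes [|x|^2 - 2 Re (f x)]. *)
Lemma riesz (f : H -> R[i]) (C : R[i]) :
  (forall a x y, f (a *: x + y) = a * f x + f y) ->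
  0 <= C -> (forall x, `|f x| <= C * `|x|) ->
  exists z, forall x, f x = inner x z.
Proof.
move=> flin C0 fC.
pose phi x := inner x x - (f x + (f x)^*).
have phi_ge x : - C ^+ 2 <= phi x.
  rewrite -subr_ge0 opprK /phi sqr_normr.
  have re : f x + (f x)^* <= (C * `|x|) *+ 2.
    rewrite (le_trans (real_ler_norm _)) //.
      by rewrite CrealE rmorphD /= conjCK addrC.
    by rewrite (le_trans (ler_normD _ _)) // norm_conjC mulr2n lerD.
  have : 0 <= (`|x| - C) ^+ 2 by rewrite real_exprn_even_ge0 // rpredB // ger0_real.
  move/le_trans; apply.
  have -> : (`|x| - C) ^+ 2 = `|x| ^+ 2 - (C * `|x|) *+ 2 + C ^+ 2 by ring.
  by rewrite lerD2r lerD2l lerN2.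
have phiE x : (complex.Re (phi x))%:C = phi x.
  have := phi_ge x; rewrite lecE => /andP[/eqP im _].
  have CC : complex.Im (- C ^+ 2) = 0.
    have : - C ^+ 2 <= 0 by rewrite oppr_le0 exprn_ge0.
    by rewrite lecE => /andP[/eqP <-].
  by case: (phi x) im => a b /= ->; rewrite CC.
pose S := range (fun x => complex.Re (phi x)).
have Sinf : has_inf S.
  split; first by exists (complex.Re (phi 0)); exists 0.
  exists (complex.Re (- C ^+ 2)) => _ [x _ <-].
  by have := phi_ge x; rewrite lecE => /andP[].
pose m := (inf S)%:C.
have m_le x : m <= phi x.
  by rewrite -phiE lecR; apply: ge_inf; [case: Sinf|exists x].
(* This tolerance makes consecutive near-minimizers [2 ^- n]-close: by the parallelogram identity
   used below, their squared distance is at most four tolerances, because [phi] is at least [m] at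
   the midpoint. *)
have m_adh n : exists x, phi x < m + 4^-1 * (2 ^- n) ^+ 2.
  have e0 : 0 < 4^-1 * (2 ^- n) ^+ 2 :> R 
    by rewrite mulr_gt0 ?exprn_gt0 ?invr_gt0 ?exprn_gt0.
  have [_ [x _ <-]] := inf_adherent e0 Sinf.
  rewrite -ltcR phiE => h; exists x; apply: lt_le_trans h _.
  by rewrite rmorphD rmorphM rmorphXn !fmorphV rmorphXn !rmorph_nat.
have [x xP] := choice m_adh.
have phiD y w a : phi (y + a *: w) =
    phi y + `|a| ^+ 2 * inner w w +
    (a * (inner w y - f w) + (a * (inner w y - f w))^*).
  rewrite /phi [y + _]addrC flin (psdDl psd) !(psdDr psd) !(psdZl psd) !(psdZr psd).
  rewrite (psd_herm psd w y) normCK !rmorphD !rmorphM /= rmorphB /=.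
  by ring.
have [z zP] : exists z, forall n, `|z - x n| <= 4 * 2 ^- n.
  apply: hilbert_complete => n.
  rewrite -(@ler_pXn2r _ 2) ?nnegrE ?invr_ge0 ?exprn_ge0 // -sqr_normr.
  set w := x n.+1 - x n; pose g := inner w (x n) - f w.
  have W1 : phi (x n.+1) = phi (x n) + inner w w + (g + g^*).
    by rewrite -[x n.+1](subrKC (x n)) -/w -[w in x n + w]scale1r phiD
      normr1 expr1n !mul1r.
  have W2 : phi (x n + 2^-1 *: w) =
      phi (x n) + (2^-1) ^+ 2 * inner w w + 2^-1 * (g + g^*).
    rewrite phiD -/g ger0_norm ?invr_ge0 // rmorphM /= fmorphV /= rmorph_nat.
    by ring.
  have -> : inner w w = 2 * (phi (x n.+1) - m) + 2 * (phi (x n) - m) -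
      4 * (phi (x n + 2^-1 *: w) - m) by rewrite W1 W2; field.
  have -> : (2 ^- n) ^+ 2 = 2 * (4^-1 * (2 ^- n) ^+ 2) +
    2 * (4^-1 * (2 ^- n) ^+ 2) - 4 * 0 :> R[i] by move: (2 ^- n) => e; field.
  rewrite !lerD //.
  - rewrite ler_wpM2l // lerBlDl (le_trans (ltW (xP _))) // lerD2l.
    rewrite ler_wpM2l ?invr_ge0 //.
    rewrite ler_pXn2r ?nnegrE ?invr_ge0 ?exprn_ge0 //.
    by rewrite exprS invfM ler_piMl ?invr_ge0 ?exprn_ge0 // invf_le1 // ler1n.
  - by rewrite ler_wpM2l // lerBlDl (ltW (xP _)).
  - by rewrite lerN2 ler_wpM2l // subr_ge0.
exists z => y; apply/eqP; rewrite -subr_eq0; apply/eqP.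
have c0 : 0 < 1 + `|y| ^+ 2 by rewrite ltr_pwDl ?exprn_ge0.
apply: (@le_geometric2_eq0 R[i]^o _ (1 + `|y| ^+ 2 + `|y| * 4)) => [|n].
  by rewrite addr_ge0 ?mulr_ge0 // ltW.
pose g := inner y (x n) - f y.
have -> : f y - inner y z = inner y (x n - z) - g.
  by rewrite (psdBr psd) /g; ring.
rewrite (le_trans (ler_normB _ _)) // addrC mulrDl lerD //; last first.
  rewrite (le_trans (inner_CauchySchwarz _ _)) // -mulrA ler_wpM2l //.
  by rewrite distrC.
(* Moving from [x n] by [(- s * g^* ) *: y] lowers [phi] by at least [s] times the squared norm of
   [g], yet not below [m]. Near-minimizers are therefore nearly critical in every direction [y]. *)
pose s := (1 + `|y| ^+ 2)^-1; have s0 : 0 < s by rewrite invr_gt0.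
have sg : s * `|g| ^+ 2 <= 4^-1 * (2 ^- n) ^+ 2.
  have := m_le (x n + (- s * g^*) *: y).
  rewrite phiD -/g.
  have -> : - s * g^* * g = - (s * `|g| ^+ 2) by rewrite normCK; ring.
  have sr : (s * `|g| ^+ 2)^* = s * `|g| ^+ 2.
    by rewrite conj_Creal // ger0_real // mulr_ge0 ?exprn_ge0 // ltW.
  rewrite rmorphN /= sr normrM normrN norm_conjC (gtr0_norm s0) sqr_normr => h.
  have sy : s ^+ 2 * `|g| ^+ 2 * `|y| ^+ 2 <= s * `|g| ^+ 2.
    have -> : s ^+ 2 * `|g| ^+ 2 * `|y| ^+ 2 = (s * `|y| ^+ 2) * (s * `|g| ^+ 2).
      by ring.
    rewrite ler_piMl ?mulr_ge0 ?exprn_ge0 ?(ltW s0) //.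
    by rewrite mulrC ler_pdivrMr // mul1r lerDr.
  have eps : phi (x n) - m <= 4^-1 * (2 ^- n) ^+ 2.
    by rewrite lerBlDl (ltW (xP n)).
  apply: le_trans eps; rewrite -subr_ge0.
  rewrite -subr_ge0 in h; rewrite -subr_ge0 in sy.
  have := addr_ge0 h sy; rewrite exprMn.
  suff -> : phi (x n) + s ^+ 2 * `|g| ^+ 2 * `|y| ^+ 2 +
    (- (s * `|g| ^+ 2) - s * `|g| ^+ 2) - m +
    (s * `|g| ^+ 2 - s ^+ 2 * `|g| ^+ 2 * `|y| ^+ 2) =
    phi (x n) - m - s * `|g| ^+ 2 by [].
  by ring.
rewrite -(@ler_pXn2r _ 2) ?nnegrE ?mulr_ge0 ?invr_ge0 ?exprn_ge0 //; last exact: ltW.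
have : `|g| ^+ 2 <= (1 + `|y| ^+ 2) * (4^-1 * (2 ^- n) ^+ 2).
  by rewrite -ler_pdivrMl.
move/le_trans; apply; rewrite exprMn mulrA ler_wpM2r ?exprn_ge0 //.
  by rewrite invr_ge0 exprn_ge0.
rewrite expr2 ler_wpM2l ?(ltW c0) // (@le_trans _ _ 1) //.
  by rewrite invf_le1 // ler1n.
by rewrite lerDl mulr_ge0.
Qed.

End Riesz.

(** * Bounded operators, C*-subalgebras and creation operators *)

Section BoundedOperators.
Variables (R : realType) (H : hilbertType R).
Implicit Types (x y z : H) (T U : H -> H).
Let psd := inner_psd H.

Lemma adjointC T U : adjoint T U -> adjoint U T.
Proof. by move=> TU x y; rewrite (psd_herm psd) -TU -(psd_herm psd). Qed.

Lemma inner_inj x y : (forall w, inner w x = inner w y) -> x = y.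
Proof.
move=> xy; apply/eqP; rewrite -subr_eq0 -(dnorm_eq0 (@inner R H)); apply/eqP.
by rewrite (psdBr psd) xy subrr.
Qed.

Lemma bounded_op_bound T : bounded_op T ->
  exists2 C : R[i], 0 <= C & forall x, `|T x| <= C * `|x|.
Proof.
move=> [Tlin Tcont].
pose f : {linear H -> H} := HB.pack T (GRing.isLinear.Build _ _ _ _ T Tlin).
have /linear_boundedP/pinfty_ex_gt0[C C0 fC] : bounded_near f (nbhs (0 : H)).
  by apply: continuous_linear_bounded; exact: Tcont.
by exists C; rewrite ?ltW.
Qed.

Lemma bounded_op_intro T (C : R[i]) : 0 <= C ->
  linear T -> (forall x, `|T x| <= C * `|x|) -> bounded_op T.
Proof.
move=> C0 Tlin TC; split => //.
pose f : {linear H -> H} := HB.pack T (GRing.isLinear.Build _ _ _ _ T Tlin).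
have : continuous f; last by [].
apply: bounded_linear_continuous; apply/linear_boundedP.
exists C; split; first exact: ger0_real.
by move=> r Cr x; rewrite (le_trans (TC x)) // ler_wpM2r // ltW.
Qed.

(** The value of the adjoint at [y] is the Riesz vector of [x |-> inner (T x) y]. Subalgebras are
    closed only under adjoints already given as bounded operators, so those of the [S_i] have to be
    produced. *)
Lemma adjoint_exists T : bounded_op T -> exists2 U, bounded_op U & adjoint T U.
Proof.
move=> Tb; have [Tlin _] := Tb; have [C C0 TC] := bounded_op_bound Tb.
have /choice[U UP] y : exists z, forall x, inner (T x) y = inner x z.
  apply: (@riesz _ _ _ (C * `|y|)) => [a x x'||x].
  - by rewrite Tlin (psd_linear psd).
  - exact: mulr_ge0.
  - rewrite (le_trans (inner_CauchySchwarz _ _)) // mulrAC ler_wpM2r //.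
have TU : adjoint T U by move=> x y; exact: UP.
exists U => //; apply: (@bounded_op_intro _ C) => // [a x y|x].
  apply: inner_inj => w.
  by rewrite (psdDr psd) (psdZr psd) -!TU (psdDr psd) (psdZr psd).
have [->|Ux0] := eqVneq (U x) 0; first by rewrite normr0 mulr_ge0.
have Ux1 : 0 < `|U x| by rewrite normr_gt0.
rewrite -(ler_pM2l Ux1) -expr2 -sqr_normr -TU.
rewrite -[X in X <= _]ger0_norm; last by rewrite TU (psd_ge0 psd).
rewrite (le_trans (inner_CauchySchwarz _ _)) // mulrA ler_wpM2r //.
by rewrite mulrC TC.
Qed.

Lemma bounded_op_cstar : cstar_subalgebra (@bounded_op R H).
Proof.
split => //.
- by apply: (@bounded_op_intro _ 0) => // [a x y|x];
    rewrite ?scaler0 ?addr0 // normr0 mul0r.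
- move=> a T U Tb Ub; have [Tlin _] := Tb; have [Ulin _] := Ub.
  have [C C0 TC] := bounded_op_bound Tb; have [C' C0' UC] := bounded_op_bound Ub.
  apply: (@bounded_op_intro _ (`|a| * C + C')) => [|b x y|x].
  + by rewrite addr_ge0 ?mulr_ge0.
  + have E z : (a *: T + U) z = a *: T z + U z by [].
    by rewrite !E Tlin Ulin !scalerDr !scalerA [b * a]mulrC addrACA.
  + rewrite (le_trans (ler_normD _ _)) // mulrDl lerD //.
    by rewrite normrZ -mulrA ler_wpM2l.
- move=> T U Tb Ub; have [Tlin _] := Tb; have [Ulin _] := Ub.
  have [C C0 TC] := bounded_op_bound Tb; have [C' C0' UC] := bounded_op_bound Ub.
  apply: (@bounded_op_intro _ (C * C')) => [|b x y|x].
  + by rewrite mulr_ge0.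
  + by rewrite /= Ulin Tlin.
  + by rewrite /= (le_trans (TC _)) // -mulrA ler_wpM2l.
Qed.

Lemma cstar_generated_bounded I (S : I -> H -> H) :
  (forall i, bounded_op (S i)) -> cstar_generated S `<=` @bounded_op R H.
Proof.
move=> Sb T; apply; split; first exact: bounded_op_cstar.
by move=> _ [i _ <-].
Qed.

Lemma cstar_generated_gen I (S : I -> H -> H) i : cstar_generated S (S i).
Proof. by move=> A [_ SA]; apply: SA; exists i. Qed.

Lemma cstar_generated_subalgebra I (S : I -> H -> H) :
  (forall i, bounded_op (S i)) -> cstar_subalgebra (cstar_generated S).
Proof.
move=> Sb; split.
- exact: cstar_generated_bounded.
- by move=> A [Aalg _]; exact: cstar_zero.
- move=> a T U TA UA A AP; have [Aalg _] := AP.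
  by apply: (cstar_linear Aalg); [exact: TA|exact: UA].
- move=> T U TA UA A AP; have [Aalg _] := AP.
  by apply: (cstar_comp Aalg); [exact: TA|exact: UA].
- move=> T U TA Ub TU A AP; have [Aalg _] := AP.
  by apply: (cstar_adjoint Aalg) TU => //; exact: TA.
- move=> T Tb TA A AP; have [Aalg _] := AP.
  apply: (cstar_closed Aalg) => // eps /TA[U UA UT].
  by exists U => //; exact: UA.
Qed.

Lemma total_orthogonal (X : set H) z : Defs.total X ->
  (forall x, X x -> inner z x = 0) -> z = 0.
Proof.
move=> Xtot zX.
have zspan w : lspan X w -> inner z w = 0.
  move=> [k [a [x [xX ->]]]]; rewrite (psd_sumr psd) big1 // => j _.
  by rewrite (psdZr psd) zX // mulr0.
have zc : closure (lspan X) z by rewrite Xtot.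
apply/eqP; rewrite -normr_eq0; apply/negPn/negP => z0.
have z1 : 0 < `|z| by rewrite lt_def z0 normr_ge0.
(* A vector [w] of the span lies closer to [z] than 0 does. As [z] is orthogonal to [w],
   Cauchy-Schwarz for [z] and [z - w] is violated. *)
have [w [wX zw]] := zc (ball z `|z|) (nbhsx_ballx z _ z1).
rewrite -ball_normE /= in zw.
have : inner z (z - w) = `|z| ^+ 2.
  by rewrite (psdBr psd) (zspan _ wX) subr0 sqr_normr.
move=> zz; have := inner_CauchySchwarz z (z - w).
rewrite zz normrX normr_id expr2 ler_pM2l //.
by move=> /le_lt_trans/(_ zw); rewrite ltxx.
Qed.

End BoundedOperators.

Section Creation.
Variables (R : realType) (I : choiceType) (Hn : hilbertType R) (e : I -> Hn).
Hypothesis e_basis : orthonormal_basis e.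
Variables (F : hilbertType R) (tens : seq Hn -> F).
Hypothesis F_fock : full_fock_space tens.
Variable S : I -> F -> F.
Hypothesis S_creation : forall i, left_creation tens (e i) (S i).
Let psd := inner_psd F.

Lemma creation_bounded i : bounded_op (S i).
Proof. by have [] := S_creation i. Qed.

Lemma creation_adjoint : exists Sa : I -> F -> F,
  forall i, [/\ bounded_op (Sa i), adjoint (S i) (Sa i) &
    forall j y, Sa i (S j y) = (i == j)%:R *: y].
Proof.
have /choice[Sa SaP] i : exists U, bounded_op U /\ adjoint (S i) U.
  by have [U] := adjoint_exists (creation_bounded i); exists U.
exists Sa => i; have [Sab Saa] := SaP i; split=> // j y.
have tt s t : inner (S i (tens s)) (S j (tens t)) =
    (i == j)%:R * inner (tens s) (tens t).
  have [_ ->] := S_creation i; have [_ ->] := S_creation j.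
  rewrite !(fock_inner F_fock) /= eqSS big_cons /= e_basis.1.
  by case: ifP => // _; rewrite mulr0.
(* The relation is first obtained on elementary tensors. For arbitrary [y] both operators are then
   moved onto the test tensor, so totality suffices and no limit in [y] is taken. *)
have ty s : Sa j (S i (tens s)) = (i == j)%:R *: tens s.
  apply/eqP; rewrite -subr_eq0; apply/eqP.
  apply: (total_orthogonal (fock_total F_fock)) => _ [t _ <-].
  have [_ Saj] := SaP j.
  by rewrite (psdBl psd) (psdZl psd) (adjointC Saj) tt subrr.
apply/eqP; rewrite -subr_eq0; apply/eqP.
apply: (total_orthogonal (fock_total F_fock)) => _ [t _ <-].
have [_ Saj] := SaP j.
rewrite (psdBl psd) (psdZl psd) (adjointC Saa) Saj ty (psdZr psd).
by rewrite rmorph_nat subrr.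
Qed.

Lemma creation_inner i j x y :
  inner (S i x) (S j y) = (i == j)%:R * inner x y.
Proof.
have [Sa /(_ i)[_ Saa SaS]] := creation_adjoint.
by rewrite Saa SaS (psdZr psd) rmorph_nat.
Qed.

Lemma vacuum_inner : inner (tens [::]) (tens [::]) = 1.
Proof. by rewrite (fock_inner F_fock) /= big_nil. Qed.

Lemma creation_vacuum i x : inner (S i x) (tens [::]) = 0.
Proof.
have [Sa /(_ i)[_ Saa _]] := creation_adjoint; rewrite Saa.
suff -> : Sa i (tens [::]) = 0 by rewrite (psd0r psd).
apply: (total_orthogonal (fock_total F_fock)) => _ [t _ <-].
rewrite (adjointC Saa); have [_ ->] := S_creation i.
by rewrite (fock_inner F_fock).
Qed.

End Creation.

(** * The Toeplitz relation and its necessity *)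

Lemma star_rep0 (R : realType) (F E : hilbertType R) (A : set (F -> F))
    (pi : (F -> F) -> E -> E) :
  cstar_subalgebra A -> star_representation A pi -> pi 0 = 0.
Proof.
move=> A_alg pi_rep.
have := star_rep_linear pi_rep 1 (cstar_zero A_alg) (cstar_zero A_alg).
rewrite !scale1r addr0 => /esym/eqP; rewrite -subr_eq0 addrK.
by move/eqP.
Qed.

Lemma star_rep_sum (R : realType) (F E : hilbertType R)
    (A : set (F -> F)) (pi : (F -> F) -> E -> E) (I : eqType) (r : seq I)
    (c : I -> R[i]) (T : I -> F -> F) :
  cstar_subalgebra A -> star_representation A pi -> (forall i, A (T i)) ->
  pi (\sum_(i <- r) c i *: T i) = \sum_(i <- r) c i *: pi (T i).
Proof.
move=> A_alg pi_rep TA.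
suff [] : A (\sum_(i <- r) c i *: T i) /\
  pi (\sum_(i <- r) c i *: T i) = \sum_(i <- r) c i *: pi (T i) by [].
elim: r => [|i r [rA rE]].
  by rewrite !big_nil (star_rep0 A_alg pi_rep); split => //; exact: cstar_zero.
rewrite !big_cons (star_rep_linear pi_rep) // rE; split => //.
exact: cstar_linear.
Qed.

Section Kernels.
Variables (R : realType) (n : option nat) (Sigma : set (word n)).
Hypothesis Sigma_adm : admissible Sigma.
Variables (H : hilbertType R) (M : word n -> H).

Definition toeplitz : Prop := forall (i j : gen n) (w v : word n),
  Sigma (i :: w) -> Sigma (j :: v) ->
  inner (M (i :: w)) (M (j :: v)) = (i == j)%:R * inner (M w) (M v).

(** Removing the first letters [j] of [alpha] and [i] of [sigma] takes out a factor [(i == j)] from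
    both kernels, and the kernels agree by definition once one of these words is empty. Conversely,
    the relation is [K3 = K4] at one-letter [alpha] and [sigma]. *)
Lemma kernels_toeplitz :
  (forall x y, Lambda Sigma x -> Lambda Sigma y -> K3 M x y = K4 M x y) <->
  toeplitz.
Proof.
split=> [K34 i j w v iw jv|M_toep].
  have := K34 ([:: j], v) ([:: i], w) jv iw; rewrite /K3 /K4 /= andbT => ->.
  by case: (eqVneq j i) => [_|_]; rewrite ?mul1r ?mul0r.
move=> [alpha beta] [sigma gamma]; rewrite /Lambda /=.
elim: alpha sigma => [|j a IH] [|i s] ja is_; rewrite /K3 /K4 /word_diff //=.
rewrite (M_toep _ _ _ _ is_ ja) eqseq_cons.
have := IH s (Sigma_adm (a := [:: j]) ja) (Sigma_adm (a := [:: i]) is_).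
rewrite /K3 /K4 /word_diff => ->.
by case: (eqVneq i j) => [_|_]; rewrite ?mul1r ?mul0r.
Qed.

End Kernels.

Section Necessity.
Variables (R : realType) (n : option nat).
Hypothesis n_gt0 : n <> Some 0%N.
Variables (Hn : hilbertType R) (e : gen n -> Hn).
Hypothesis e_basis : orthonormal_basis e.
Variables (F : hilbertType R) (tens : seq Hn -> F).
Hypothesis F_fock : full_fock_space tens.
Variable S : gen n -> F -> F.
Hypothesis S_creation : forall i, left_creation tens (e i) (S i).

Let S_bounded := creation_bounded S_creation.
Let A_alg := cstar_generated_subalgebra S_bounded.

Lemma gen_inhabited : gen n.
Proof.
by case: n n_gt0 => [[|m]|] h; [case: h|exact: (ord0 : 'I_m.+1)|exact: 0%N].
Qed.

(** Subalgebras are not assumed to contain the identity. The empty product is in the generated one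
    because [Sa i \o S i = id], which takes at least one generator. *)
Lemma word_prod_in w : cstar_generated S (word_prod S w).
Proof.
have [Sa SaP] := creation_adjoint e_basis F_fock S_creation.
elim: w => [|i w IH] /=; last first.
  by apply: (cstar_comp A_alg) => //; exact: cstar_generated_gen.
have [Sab Saa SaS] := SaP gen_inhabited.
have S_in : cstar_generated S (S gen_inhabited) by exact: cstar_generated_gen.
have Sa_in := cstar_adjoint A_alg S_in Sab Saa.
have <- : Sa gen_inhabited \o S gen_inhabited = id.
  by apply/funext => x /=; rewrite SaS eqxx scale1r.
exact: (cstar_comp A_alg Sa_in S_in).
Qed.

Lemma dilation_toeplitz (E : hilbertType R) (pi : (F -> F) -> (E -> E)) (h : E) :
  star_representation (cstar_generated S) pi ->
  forall i j w v, inner (pi (word_prod S (i :: w)) h) (pi (word_prod S (j :: v)) h) =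
    (i == j)%:R * inner (pi (word_prod S w) h) (pi (word_prod S v) h).
Proof.
move=> pi_rep i j w v.
have [Sa SaP] := creation_adjoint e_basis F_fock S_creation.
have [Sab Saa SaS] := SaP i.
have S_in k : cstar_generated S (S k) by exact: cstar_generated_gen.
have Sa_in := cstar_adjoint A_alg (S_in i) Sab Saa.
have comp T U y (TA : cstar_generated S T) (UA : cstar_generated S U) :
    pi T (pi U y) = pi (T \o U) y by rewrite (star_rep_comp pi_rep TA UA).
have piE k u : pi (word_prod S (k :: u)) h = pi (S k) (pi (word_prod S u) h).
  by rewrite (comp _ _ _ (S_in k) (word_prod_in u)).
rewrite !piE (star_rep_adjoint pi_rep (S_in i) Sa_in Saa).
rewrite (comp _ _ _ Sa_in (S_in j)).
have id_in : cstar_generated S id by exact: (word_prod_in [::]).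
have -> : Sa i \o S j = (i == j)%:R *: id + 0.
  by apply/funext => y; rewrite /= SaS addr0.
rewrite (star_rep_linear pi_rep _ id_in (cstar_zero A_alg)).
rewrite (star_rep0 A_alg pi_rep) addr0.
(* [pi] may be non-unital, but [pi id] fixes the vectors [pi (word_prod S v) h]. *)
have -> : ((i == j)%:R *: pi id) (pi (word_prod S v) h) =
    (i == j)%:R *: pi (word_prod S v) h.
  by rewrite -[LHS]/(_ *: pi id (pi (word_prod S v) h))
    (comp _ _ _ id_in (word_prod_in v)).
by rewrite (psdZr (inner_psd E)) rmorph_nat.
Qed.

End Necessity.

Lemma indicator_polynomial (R : realType) (n : option nat) (w : word n) :
  exists2 p : {fsfun word n -> R[i] with 0},
    (forall v, v \in finsupp p -> v = w) &
    forall (V : lmodType R[i]) (M : word n -> V), linear_extension M p = M w.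
Proof.
pose p : {fsfun word n -> R[i] with 0} := [fsfun [fsfun] with w |-> 1].
have pE : finsupp p = [fset w]%fset.
  by rewrite finsupp_with oner_eq0 finsupp0 fsetU0.
exists p => [v|V M]; first by rewrite pE inE => /eqP.
by rewrite /linear_extension pE big_seq_fset1 fsfun_with scale1r.
Qed.

(** * Gram-Schmidt and the truncated shifts *)

Section GramSchmidt.
Variables (C : numClosedFieldType) (V : lmodType C) (b : V -> V -> C).
Hypothesis b_psd : psd_form b.

(** The reconstruction formula of a Parseval frame. Orthonormality of [s] is not asked, so enlarging
    the list of vectors to be expanded is the only condition put on the families later. *)
Definition expands (s : seq V) (v : V) : Prop :=
  v = \sum_(u <- s) b v u *: u.

Lemma expands_linear s a v w :
  expands s v -> expands s w -> expands s (a *: v + w).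
Proof.
move=> vE wE; rewrite /expands {1}vE {1}wE scaler_sumr -big_split /=.
by apply: eq_bigr => u _; rewrite scalerA -scalerDl (psd_linear b_psd).
Qed.

Lemma expands0 s : expands s 0.
Proof. by rewrite /expands big1 // => u _; rewrite (psd0l b_psd) scale0r. Qed.

Lemma expands_sum (I : eqType) (s : seq V) (r : seq I) (c : I -> C) (f : I -> V) :
  (forall i, i \in r -> expands s (f i)) ->
  expands s (\sum_(i <- r) c i *: f i).
Proof.
elim: r => [|i r IH] fE; first by rewrite big_nil; exact: expands0.
rewrite big_cons; apply: expands_linear; first by apply: fE; rewrite mem_head.
by apply: IH => j jr; apply: fE; rewrite inE jr orbT.
Qed.

Lemma expands_form s v w : expands s v ->
  b v w = \sum_(u <- s) b v u * (b w u)^*.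
Proof.
move=> vE; rewrite {1}vE (psd_suml b_psd); apply: eq_bigr => u _.
by rewrite (psdZl b_psd) (psd_herm b_psd w u).
Qed.

Definition orthonormal_seq (s : seq V) : Prop :=
  uniq s /\ {in s &, forall u v, b u v = (u == v)%:R}.

Lemma orthonormal_coord s (c : V -> C) v : orthonormal_seq s -> v \in s ->
  b (\sum_(u <- s) c u *: u) v = c v.
Proof.
move=> [s_uniq s_on] vs; rewrite (psd_suml b_psd) (bigD1_seq v) //=.
rewrite (psdZl b_psd) s_on // eqxx mulr1 big_seq_cond big1 ?addr0 // => u.
by move=> /andP[us uv]; rewrite (psdZl b_psd) s_on // (negbTE uv) mulr0.
Qed.

Lemma gram_schmidt (L : set V) (l : seq V) :
  (forall a v w, L v -> L w -> L (a *: v + w)) -> L 0 ->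
  (forall v, L v -> b v v = 0 -> v = 0) ->
  (forall v, v \in l -> L v) ->
  exists s, [/\ orthonormal_seq s, (forall u, u \in s -> L u) &
    (forall v, v \in l -> expands s v)].
Proof.
move=> L_lin L_0 L_def; elim: l => [|v l IH] lL; first by exists [::].
have [|s [s_on sL sE]] := IH; first by move=> w wl; apply: lL; rewrite inE wl orbT.
have Lsum (t : seq V) (c : V -> C) : (forall u, u \in t -> L u) ->
    L (\sum_(u <- t) c u *: u).
  elim: t => [|u t IHt] tL; first by rewrite big_nil.
  rewrite big_cons; apply: L_lin; first by apply: tL; rewrite mem_head.
  by apply: IHt => w wt; apply: tL; rewrite inE wt orbT.
pose w := v - \sum_(u <- s) b v u *: u.
have Lv : L v by apply: lL; rewrite mem_head.
have Lw : L w.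
  by rewrite /w addrC -scaleN1r; apply: L_lin => //; exact: Lsum.
have ws u : u \in s -> b w u = 0.
  by move=> us; rewrite (psdBl b_psd) orthonormal_coord // subrr.
have [w0|w0] := eqVneq w 0.
  exists s; split=> // x; rewrite inE => /predU1P[->|/sE//].
  by apply/eqP; rewrite -subr_eq0 -/w w0.
have bw : b w w != 0 by apply: contra w0 => /eqP/(L_def _ Lw) ->.
pose N := psd_norm b w.
have N0 : N != 0 by rewrite sqrtC_eq0.
have Nr : N^* = N by rewrite conj_Creal // ger0_real // psd_norm_ge0.
pose u0 := N^-1 *: w.
have u0s u : u \in s -> b u0 u = 0.
  by move=> us; rewrite (psdZl b_psd) ws // mulr0.
have su0 u : u \in s -> b u u0 = 0.
  by move=> us; rewrite (psd_herm b_psd) u0s // rmorph0.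
have u0u0 : b u0 u0 = 1.
  rewrite (psdZl b_psd) (psdZr b_psd) fmorphV /= Nr -(sqr_psd_norm b w) -/N.
  by field.
have u0N : u0 \notin s.
  by apply/negP => /u0s; rewrite u0u0 => /eqP; rewrite oner_eq0.
have [s_uniq s_orth] := s_on.
exists (u0 :: s); split.
- split; first by rewrite /= u0N.
  move=> x y; rewrite !inE => /predU1P[->|xs] /predU1P[->|ys].
  + by rewrite eqxx.
  + by rewrite u0s //; case: eqP ys u0N => // -> ->.
  + by rewrite su0 //; case: eqP xs u0N => // -> ->.
  + exact: s_orth.
- move=> u; rewrite inE => /predU1P[->|/sL//].
  by rewrite /u0 -[_ *: w]addr0; exact: L_lin.
- move=> x; rewrite inE /expands big_cons => /predU1P[->|xl].
    have -> : b v u0 = N.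
      rewrite -(subrK (\sum_(u <- s) b v u *: u) v) -/w (psdDl b_psd).
      rewrite (psd_suml b_psd) [X in _ + X]big_seq big1 => [|u us].
        rewrite addr0 (psdZr b_psd) fmorphV /= Nr -(sqr_psd_norm b w) -/N.
        by field.
      by rewrite (psdZl b_psd) su0 // mulr0.
    by rewrite scalerA mulfV // scale1r /w subrK.
  rewrite {2}(sE x xl) (psd_suml b_psd) big_seq big1 => [|u us].
    by rewrite scale0r add0r; exact: sE.
  by rewrite (psdZl b_psd) su0 // mulr0.
Qed.

End GramSchmidt.

Record partial_isometries (R : realType) (H : hilbertType R) (I : eqType)
    (T B : I -> H -> H) : Prop := PartialIsometries {
  pisom_linear : forall i, linear (T i);
  pisom_adjoint : forall i, adjoint (T i) (B i);
  pisom_orthogonal : forall i j x, i != j -> B i (T j x) = 0;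
  pisom_partial : forall i x, T i (B i (T i x)) = T i x }.

Section Shifts.
Variables (R : realType) (H : hilbertType R) (n : option nat).
Variables (Sigma : set (word n)) (M : word n -> H).
Hypothesis M_toep : toeplitz Sigma M.
Let psd := inner_psd H.

(** Degenerate on pairs, yet definite on each [shift_graph i]: by the Toeplitz relation the two
    coordinates of a graph element have equal norms. Orthonormalizing inside the graph thus handles
    linear dependences among the [M w] and carries their images along. *)
Let pair_form (p q : H * H) : R[i] := inner p.1 q.1.

Let pair_psd : psd_form pair_form.
Proof.
split=> [a p q r|p q|p]; rewrite /pair_form /=.
- exact: (psd_linear psd).
- exact: (psd_herm psd).
- exact: (psd_ge0 psd).
Qed.

Variable ws : seq (word n).

Let dom i := undup [seq w <- ws | `[< Sigma (i :: w) >]].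

Definition shift_graph (i : gen n) : set (H * H) :=
  [set p | exists c : word n -> R[i],
  p = (\sum_(w <- dom i) c w *: M w, \sum_(w <- dom i) c w *: M (i :: w))].

Lemma shift_graph_inner i j p q : shift_graph i p -> shift_graph j q ->
  inner p.2 q.2 = (i == j)%:R * inner p.1 q.1.
Proof.
move=> [c ->] [d ->] /=; rewrite !(psd_suml psd) mulr_sumr.
apply: eq_big_seq => w; rewrite mem_undup mem_filter => /andP[/asboolP iw _].
rewrite !(psd_sumr psd) mulr_sumr.
apply: eq_big_seq => v; rewrite mem_undup mem_filter => /andP[/asboolP jv _].
rewrite !(psdZl psd) !(psdZr psd) M_toep //.
by ring.
Qed.

Lemma shift_graph_pair i w : w \in dom i -> shift_graph i (M w, M (i :: w)).
Proof.
move=> wi; exists (fun v => (v == w)%:R).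
by congr pair; rewrite (bigD1_seq w) ?undup_uniq //= eqxx scale1r big1 ?addr0 //
  => v /negbTE ->; rewrite scale0r.
Qed.

Lemma shift_graph_basis i : exists s : seq (H * H),
  [/\ orthonormal_seq pair_form s, (forall p, p \in s -> shift_graph i p) &
    forall w, w \in ws -> Sigma (i :: w) ->
      expands pair_form s (M w, M (i :: w))].
Proof.
have [||||s [s_on sL sE]] := @gram_schmidt _ _ _ pair_psd (shift_graph i)
    [seq (M w, M (i :: w)) | w <- dom i].
- move=> a _ _ [c ->] [d ->]; exists (fun w => a * c w + d w).
  by congr pair; rewrite /= scaler_sumr -big_split; apply: eq_bigr => w _ /=;
    rewrite scalerA -scalerDl.
- by exists (fun=> 0); congr pair; rewrite big1 // => w _; rewrite scale0r.
- move=> p Lp p0; have := shift_graph_inner Lp Lp.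
  rewrite eqxx mul1r -/(pair_form p p) p0 => /eqP; rewrite dnorm_eq0 => /eqP p2.
  move: p0 => /eqP; rewrite /pair_form dnorm_eq0 => /eqP p1.
  by move: p p1 p2 {Lp} => [x y] /= -> ->.
- by move=> _ /mapP[w wl ->]; exact: shift_graph_pair.
- exists s; split=> // w wws iw; apply: sE; apply: map_f.
  by rewrite mem_undup mem_filter wws andbT; apply/asboolP.
Qed.

Lemma shift_partial_isometries (g : seq (gen n)) :
  exists (T B : gen n -> H -> H) (s : seq H), [/\ partial_isometries T B,
    forall us x i, i \in g -> (forall v, v \in s -> expands inner us v) ->
      expands inner us (T i x) /\ expands inner us (B i x) &
    forall i w, w \in ws -> Sigma (i :: w) ->
      T i (M w) = M (i :: w) /\ B i (M (i :: w)) = M w].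
Proof.
have [s sP] := choice shift_graph_basis.
(* The first coordinates of [s i] form an orthonormal basis of the span of the [M w], the second
   coordinates one of the span of the [M (i :: w)], for [w] in [dom i]. [T i] maps the former to the
   latter and kills the orthogonal complement. *)
pose T i x := \sum_(p <- s i) inner x p.1 *: p.2.
pose B i x := \sum_(p <- s i) inner x p.2 *: p.1.
exists T, B, (flatten [seq [seq p.1 | p <- s i] ++ [seq p.2 | p <- s i] | i <- g]).
have s12 i p q : p \in s i -> q \in s i -> inner p.2 q.2 = inner p.1 q.1.
  have [_ sL _] := sP i => /sL Lp /sL Lq.
  by rewrite (shift_graph_inner Lp Lq) eqxx mul1r.
have s11 i c p : p \in s i -> inner (\sum_(q <- s i) c q *: q.1) p.1 = c p.
  move=> ps; have [s_on _ _] := sP i.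
  rewrite -[RHS](orthonormal_coord pair_psd c s_on ps) (psd_suml psd).
  rewrite (psd_suml pair_psd); apply: eq_bigr => q _.
  by rewrite (psdZl psd) (psdZl pair_psd).
have BT i x : B i (T i x) = \sum_(p <- s i) inner x p.1 *: p.1.
  apply: eq_big_seq => p ps; congr (_ *: _).
  rewrite -[RHS](s11 i (fun q => inner x q.1) p ps) !(psd_suml psd).
  by apply: eq_big_seq => q qs; rewrite !(psdZl psd) (s12 i).
split.
- split.
  + move=> i a x y; rewrite /T scaler_sumr -big_split; apply: eq_bigr => p _ /=.
    by rewrite (psd_linear psd) scalerDl scalerA.
  + move=> i x y; rewrite (psd_suml psd) (psd_sumr psd); apply: eq_bigr => p _.
    by rewrite (psdZl psd) (psdZr psd) -(psd_herm psd) mulrC.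
  + move=> i j x ij; rewrite /B big_seq big1 // => p pi.
    rewrite (psd_suml psd) big_seq big1 ?scale0r // => q qj.
    have [_ /(_ p pi) Lp _] := sP i; have [_ /(_ q qj) Lq _] := sP j.
    rewrite (psdZl psd) (shift_graph_inner Lq Lp) eq_sym (negbTE ij).
    by rewrite mul0r mulr0.
  + move=> i x; rewrite BT; apply: eq_big_seq => p ps.
    by rewrite (s11 i (fun q => inner x q.1)).
- move=> us x i ig usE.
  split; apply: (expands_sum psd) => p ps; apply: usE; apply/flattenP.
  + exists ([seq p.1 | p <- s i] ++ [seq p.2 | p <- s i]); first exact: map_f.
    by rewrite mem_cat map_f ?orbT.
  + exists ([seq p.1 | p <- s i] ++ [seq p.2 | p <- s i]); first exact: map_f.
    by rewrite mem_cat map_f.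
- move=> i w wws iw; have [_ _ /(_ w wws iw) wE] := sP i.
  (* [wE] holds in both coordinates with the same coefficients, since [pair_form] reads first
     coordinates only. *)
  have sum1 : M w = \sum_(p <- s i) inner (M w) p.1 *: p.1.
    rewrite {1}[M w](congr1 fst wE).
    exact: (big_morph (fun p : H * H => p.1) (fun _ _ => erefl) erefl).
  have sum2 : M (i :: w) = \sum_(p <- s i) inner (M w) p.1 *: p.2.
    rewrite {1}[M (i :: w)](congr1 snd wE).
    exact: (big_morph (fun p : H * H => p.2) (fun _ _ => erefl) erefl).
  split; first exact: esym.
  rewrite [RHS]sum1; apply: eq_big_seq => p ps; congr (_ *: _).
  have [_ /(_ p ps) Lp _] := sP i.
  have Lw : shift_graph i (M w, M (i :: w)).
    apply: shift_graph_pair; rewrite mem_undup mem_filter wws andbT.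
    exact/asboolP.
  by rewrite (shift_graph_inner Lw Lp) eqxx mul1r.
Qed.

End Shifts.

(** * Fejer means of the Poisson kernel *)

Section TensorForm.
Variables (R : realType) (H F : hilbertType R).
Let psdF := inner_psd F.
Let psdH := inner_psd H.

(* The functions [H -> F] with the form [tensor_form us], for a Parseval
   family [us] of a subspace of [H], stand in for the Hilbert tensor product of
   [F] and this subspace: [simple_tensor f v] corresponds to f (x) v. *)
Definition tensor_form (us : seq H) (x y : H -> F) : R[i] :=
  \sum_(u <- us) inner (x u) (y u).

Definition simple_tensor (f : F) (v : H) : H -> F := fun u => inner v u *: f.

Lemma tensor_psd us : psd_form (tensor_form us).
Proof.
split=> [a x y z|x y|x]; rewrite /tensor_form.
- rewrite mulr_sumr -big_split; apply: eq_bigr => u _ /=.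
  exact: (psd_linear psdF).
- by rewrite rmorph_sum; apply: eq_bigr => u _; exact: (psd_herm psdF).
- by apply: sumr_ge0 => u _; exact: (psd_ge0 psdF).
Qed.

Lemma tensor_form_simple us f h v w : expands inner us v ->
  tensor_form us (simple_tensor f v) (simple_tensor h w) = inner v w * inner f h.
Proof.
move=> vE; rewrite (expands_form psdH _ vE) mulr_suml; apply: eq_bigr => u _.
by rewrite (psdZl psdF) (psdZr psdF) mulrA.
Qed.

End TensorForm.

Section Fejer.
Variables (R : realType) (H F : hilbertType R) (I : eqType).
Variables (vac : F) (S : I -> F -> F).
Hypothesis vac_inner : inner vac vac = 1.
Hypothesis S_linear : forall i, linear (S i).
Hypothesis S_inner :
  forall i j x y, inner (S i x) (S j y) = (i == j)%:R * inner x y.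
Hypothesis S_vac : forall i x, inner (S i x) vac = 0.
Variables (T B : I -> H -> H) (g : seq I).
Hypothesis TB : partial_isometries T B.
Hypothesis g_uniq : uniq g.
Let psdF := inner_psd F.
Let psdH := inner_psd H.

Let B_linear i : linear (B i).
Proof.
move=> a x y; apply: inner_inj => w; rewrite (psdDr psdH) (psdZr psdH).
by rewrite -!(pisom_adjoint TB) (psdDr psdH) (psdZr psdH).
Qed.

Let T0 i : T i 0 = 0. Proof. exact: linear_at0 (pisom_linear TB i). Qed.
Let S0 i : S i 0 = 0. Proof. exact: linear_at0. Qed.

(** The product of the row of the [T i] with its adjoint. It is a projection, so [1 - Q] is its own
    square root: it is also the defect operator in the Poisson kernel. *)
Definition range_proj (x : H) : H := \sum_(i <- g) T i (B i x).
Local Notation Q := range_proj.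

Lemma range_proj_linear : linear Q.
Proof.
move=> a x y; rewrite /Q scaler_sumr -big_split; apply: eq_bigr => i _ /=.
by rewrite B_linear (pisom_linear TB).
Qed.

Lemma range_proj_inner x y : inner (Q x) y = \sum_(i <- g) inner (B i x) (B i y).
Proof.
by rewrite (psd_suml psdH); apply: eq_bigr => i _; rewrite (pisom_adjoint TB).
Qed.

Lemma range_proj_sym x y : inner (Q x) y = inner x (Q y).
Proof.
rewrite [RHS](psd_herm psdH) !range_proj_inner rmorph_sum.
by apply: eq_bigr => i _; exact: (psd_herm psdH).
Qed.

Lemma range_projT i x : i \in g -> Q (T i x) = T i (B i (T i x)).
Proof.
move=> ig; rewrite /Q (bigD1_seq i) //= big1 ?addr0 // => j ji.
by rewrite (pisom_orthogonal TB) // T0.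
Qed.

Lemma range_projK x : Q (Q x) = Q x.
Proof.
suff QE (r : seq I) : {subset r <= g} ->
    Q (\sum_(i <- r) T i (B i x)) = \sum_(i <- r) T i (B i x) by exact: QE.
elim: r => [|i r IH] rg.
  by rewrite big_nil; exact: linear_at0 range_proj_linear.
rewrite big_cons -[T i _]scale1r range_proj_linear IH; last first.
  by move=> j jr; rewrite rg // inE jr orbT.
by rewrite range_projT ?rg ?mem_head // (pisom_partial TB).
Qed.

Lemma range_projKr x y : inner (Q x) (Q y) = inner (Q x) y.
Proof. by rewrite range_proj_sym range_projK -range_proj_sym. Qed.

Lemma range_proj_compl x y : inner (x - Q x) (y - Q y) = inner x y - inner (Q x) y.
Proof.
rewrite (psdBl psdH) !(psdBr psdH) -range_proj_sym range_projKr.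
by ring.
Qed.

Lemma range_proj_form x y (a : R[i]) : a^* = a ->
  inner (a *: (x - Q x) + Q x) (a *: (y - Q y) + Q y) =
  a ^+ 2 * (inner x y - inner (Q x) y) + inner (Q x) y.
Proof.
move=> ar; rewrite -range_proj_compl -(range_projKr x y).
have xy z w : inner (Q z) (w - Q w) = 0.
  by rewrite (psdBr psdH) range_projKr subrr.
rewrite (psdDl psdH) !(psdDr psdH) !(psdZl psdH) !(psdZr psdH) ar.
by rewrite xy (psd_herm psdH (Q y)) xy rmorph0; ring.
Qed.

(* [fejer k x] is, up to the factor [sqrt k], the Fejer mean of order [k] of the
   Poisson kernel of the row contraction [T] applied to [x]. *)
Fixpoint fejer (k : nat) (x : H) : H -> F :=
  if k is k'.+1 then
    simple_tensor vac (sqrtC k%:R *: (x - Q x) + Q x) +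
    \sum_(i <- g) (S i \o fejer k' (B i x))
  else 0.

Arguments fejer : simpl never.

Lemma fejerS k x : fejer k.+1 x =
  simple_tensor vac (sqrtC k.+1%:R *: (x - Q x) + Q x) +
  \sum_(i <- g) (S i \o fejer k (B i x)).
Proof. by []. Qed.

Lemma fejerE k x u : fejer k.+1 x u =
  inner (sqrtC k.+1%:R *: (x - Q x) + Q x) u *: vac +
  \sum_(i <- g) S i (fejer k (B i x) u).
Proof. by rewrite fejerS -[LHS]/(_ + _) fct_sumE. Qed.

Lemma fejer_linear k a x y : fejer k (a *: x + y) = a *: fejer k x + fejer k y.
Proof.
elim: k a x y => [|k IH] a x y; first by rewrite /fejer scaler0 addr0.
apply/funext => u; rewrite -[RHS]/(a *: fejer k.+1 x u + fejer k.+1 y u).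
rewrite !fejerE range_proj_linear.
have -> : sqrtC k.+1%:R *: (a *: x + y - (a *: Q x + Q y)) + (a *: Q x + Q y) =
    a *: (sqrtC k.+1%:R *: (x - Q x) + Q x) + (sqrtC k.+1%:R *: (y - Q y) + Q y).
  rewrite opprD addrACA -scalerBr !scalerDr !scalerA [_ * a]mulrC addrACA.
  by [].
rewrite (psd_linear psdH) scalerDl -scalerA [in RHS]scalerDr [RHS]addrACA.
congr (_ + _).
rewrite scaler_sumr -big_split; apply: eq_bigr => i _ /=.
by rewrite -S_linear B_linear IH.
Qed.

Lemma fejer0 k : fejer k 0 = 0.
Proof. exact/linear_at0/fejer_linear. Qed.

Variable us : seq H.
Hypothesis us_TB : forall x i, i \in g ->
  expands inner us (T i x) /\ expands inner us (B i x).

Lemma expands_sub v w : expands inner us v -> expands inner us w ->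
  expands inner us (v - w).
Proof. by move=> vE wE; rewrite addrC -scaleN1r; exact: (expands_linear psdH). Qed.

Lemma expands_range_proj x : expands inner us (Q x).
Proof.
have -> : Q x = \sum_(i <- g) 1 *: T i (B i x).
  by apply: eq_bigr => i _; rewrite scale1r.
apply: (@expands_sum _ _ _ psdH _ us g (fun=> 1) (fun i => T i (B i x))) => i ig.
by have [] := us_TB (B i x) ig.
Qed.

Lemma expands_step x (a : R[i]) : expands inner us x ->
  expands inner us (a *: (x - Q x) + Q x).
Proof.
move=> xE; apply: (expands_linear psdH); last exact: expands_range_proj.
by apply: expands_sub => //; exact: expands_range_proj.
Qed.

(** The vacuum and the ranges of the [S i] are mutually orthogonal, so there are no cross terms. *)
Lemma tensor_form_step v w (f h : I -> H -> F) : expands inner us v ->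
  tensor_form us (simple_tensor vac v + \sum_(i <- g) (S i \o f i))
    (simple_tensor vac w + \sum_(i <- g) (S i \o h i)) =
  inner v w + \sum_(i <- g) tensor_form us (f i) (h i).
Proof.
move=> vE; have tpsd := tensor_psd F us.
have SS i j x y : tensor_form us (S i \o x) (S j \o y) =
    (i == j)%:R * tensor_form us x y.
  by rewrite mulr_sumr; apply: eq_bigr => u _; rewrite S_inner.
have Sv i x z : tensor_form us (S i \o x) (simple_tensor vac z) = 0.
  by rewrite /tensor_form big1 // => u _; rewrite (psdZr psdF) S_vac mulr0.
rewrite (psdDl tpsd) !(psdDr tpsd) tensor_form_simple // vac_inner mulr1 -addrA.
congr (_ + _).
rewrite (psd_suml tpsd) [X in _ + (X + _)]big1 => [|i _]; last exact: Sv.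
rewrite (psd_sumr tpsd) big1 ?add0r => [|i _]; last first.
  by rewrite (psd_herm tpsd) Sv rmorph0.
rewrite (psd_suml tpsd); apply: eq_big_seq => i ig.
rewrite (psd_sumr tpsd) (bigD1_seq i) //= SS eqxx mul1r big1 ?addr0 // => j ji.
by rewrite SS eq_sym (negbTE ji) mul0r.
Qed.

Let sqrtC_real k : (sqrtC (k%:R : R[i]))^* = sqrtC k%:R.
Proof. by rewrite conj_Creal // ger0_real // sqrtC_ge0. Qed.

(** As [Q] is a projection, the vacuum term at order [k.+1] contributes [(k+1)(1 - Q) + Q]. The
    recursive terms contribute [k] times the sum of the [T i \o B i], that is [k Q], which completes
    this to [k+1]. *)
Lemma fejer_inner k x y : expands inner us x -> 
  tensor_form us (fejer k x) (fejer k y) = k%:R * inner x y.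
Proof.
elim: k x y => [|k IH] x y xE; first by rewrite mul0r (psd0l (tensor_psd F us)).
rewrite tensor_form_step; last exact: expands_step.
rewrite (eq_big_seq (fun i => k%:R * inner (B i x) (B i y))); last first.
  by move=> i ig; apply: IH; have [] := us_TB x ig.
rewrite -mulr_sumr -range_proj_inner range_proj_form // sqrtCK -[in LHS]natr1.
rewrite -[in RHS]natr1; ring.
Qed.

Lemma sqrtC_succ_diff k :
  (sqrtC k.+1%:R - sqrtC k%:R) ^+ 2 <= 1 :> R[i].
Proof.
have a0 : 0 <= sqrtC k%:R :> R[i] by rewrite sqrtC_ge0.
have ab : sqrtC k%:R <= sqrtC k.+1%:R :> R[i] by rewrite ler_sqrtC ?nnegrE ?ler_nat.
have E1 : (sqrtC k.+1%:R - sqrtC k%:R) * (sqrtC k.+1%:R + sqrtC k%:R) = 1 :> R[i].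
  by rewrite -subr_sqr !sqrtCK -natrB // subSnn.
rewrite -[leRHS]E1 expr2 ler_wpM2l ?subr_ge0 // lerD2l.
by rewrite (le_trans _ a0) // oppr_le0.
Qed.

(** Raising the order changes the weight of [1 - Q] on each level by a difference of consecutive
    square roots, at most 1. The levels add up because [|x - Q x|^2] plus the sum of the [|B i x|^2]
    is [|x|^2]; the one new level is the base case. *)
Lemma fejer_diff k x : expands inner us x ->
  tensor_form us (fejer k.+1 x - fejer k x) (fejer k.+1 x - fejer k x) <= inner x x.
Proof.
elim: k x => [|k IH] x xE; first by rewrite subr0 fejer_inner // mul1r.
pose d : R[i] := sqrtC k.+2%:R - sqrtC k.+1%:R.
pose y := d *: (x - Q x).
have E : fejer k.+2 x - fejer k.+1 x = simple_tensor vac y +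
    \sum_(i <- g) (S i \o (fejer k.+1 (B i x) - fejer k (B i x))).
  apply/funext => u; rewrite -[LHS]/(fejer k.+2 x u - fejer k.+1 x u).
  rewrite !fejerE -[RHS]/(simple_tensor vac y u + _) fct_sumE.
  rewrite opprD addrACA -sumrB; congr (_ + _).
    rewrite -scalerBl -(psdBl psdH); congr (inner _ _ *: _).
    by rewrite opprD addrACA subrr addr0 -scalerBl.
  apply: eq_bigr => i _ /=.
  by rewrite -(linear_atB _ _ (S_linear i)).
have yE : expands inner us y.
  rewrite /y -[_ *: _](addrK (Q x)); apply: expands_sub.
    exact: expands_step.
  exact: expands_range_proj.
rewrite E tensor_form_step //.
have dr : d^* = d by rewrite rmorphB /= !sqrtC_real.
have -> : inner y y = d ^+ 2 * (inner x x - inner (Q x) x).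
  by rewrite (psdZl psdH) (psdZr psdH) dr range_proj_compl mulrA -expr2.
rewrite -[leRHS](subrK (inner (Q x) x)) lerD //.
  by rewrite -range_proj_compl ler_piMl ?sqrtC_succ_diff // (psd_ge0 psdH).
rewrite range_proj_inner big_seq [leRHS]big_seq; apply: ler_sum => i ig.
by apply: IH; have [] := us_TB x ig.
Qed.

Lemma fejerT k i x : i \in g -> B i (T i x) = x ->
  fejer k.+1 (T i x) = simple_tensor vac (T i x) + (S i \o fejer k x).
Proof.
move=> ig BTx; rewrite fejerS range_projT // BTx subrr scaler0 add0r; congr (_ + _).
rewrite (bigD1_seq i) //= BTx big1 ?addr0 // => j ji.
by rewrite (pisom_orthogonal TB) // fejer0; apply/funext => u; exact: S0.
Qed.

(** The error is [T i x] on the vacuum plus [S i] applied to a difference of consecutive orders;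
    each has norm at most that of [x]. The bound is independent of [k], so it vanishes after
    normalization. *)
Lemma fejer_intertwining k i x : i \in g -> B i (T i x) = x ->
  expands inner us x ->
  tensor_form us (fejer k.+1 (T i x) - (S i \o fejer k.+1 x))
    (fejer k.+1 (T i x) - (S i \o fejer k.+1 x)) <= 2 * inner x x.
Proof.
move=> ig BTx xE; rewrite fejerT //.
have -> : simple_tensor vac (T i x) + (S i \o fejer k x) - (S i \o fejer k.+1 x) =
    simple_tensor vac (T i x) +
    \sum_(j <- g) (S j \o (if j == i then - (fejer k.+1 x - fejer k x) else 0)).
  rewrite -addrA; congr (_ + _); rewrite (bigD1_seq i) //= eqxx big1 ?addr0.
    apply/funext => u; rewrite -[LHS]/(S i (fejer k x u) - S i (fejer k.+1 x u)).
    rewrite /= -[in RHS]/(- (fejer k.+1 x u - fejer k x u)) opprB.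
    by rewrite (linear_atB _ _ (S_linear i)).
  by move=> j /negbTE ->; apply/funext => u; exact: S0.
have [TE _] := us_TB x ig.
rewrite tensor_form_step // (pisom_adjoint TB) BTx mulr_natl mulr2n lerD2l.
rewrite (bigD1_seq i) //= eqxx big1 ?addr0; last first.
  by move=> j /negbTE ->; rewrite (psd0l (tensor_psd F us)).
by rewrite (psdNl (tensor_psd F us)) (psdNr (tensor_psd F us)) opprK fejer_diff.
Qed.

End Fejer.

Arguments fejer : simpl never.

(** * The representation on the ultraproduct *)

Section UltraproductRepresentation.
Variables (R : realType) (H F : hilbertType R) (D : choiceType).
Variables (U : set_system D) (us : D -> seq H) (E : hilbertType R).
Variable q : (D -> H -> F) -> E.
Hypothesis U_ultra : UltraFilter U.
Let p d := @tensor_form R H F (us d).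
Let p_psd d : psd_form (p d) := tensor_psd F (us d).
Hypothesis q_linear : forall a x y, ubounded U p x -> ubounded U p y ->
  q (a *: x + y) = a *: q x + q y.
Hypothesis q_cvg : forall x y, ubounded U p x -> ubounded U p y ->
  (fun d => p d (x d) (y d) : R[i]^o) @ U --> (inner (q x) (q y) : R[i]^o).
Hypothesis q_surj : forall f, exists2 x, ubounded U p x & q x = f.

Lemma ubounded_sub x y : ubounded U p x -> ubounded U p y -> ubounded U p (x - y).
Proof.
by move=> xb yb; rewrite addrC -scaleN1r; exact: (ubounded_linear U_ultra p_psd).
Qed.

Lemma ultra_q_sub x y : ubounded U p x -> ubounded U p y -> q (x - y) = q x - q y.
Proof.
by move=> xb yb; rewrite addrC -scaleN1r q_linear // scaleN1r addrC.
Qed.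

Lemma ultra_q_eq x y : ubounded U p x -> ubounded U p y ->
  (forall e : R[i], 0 < e -> \forall d \near U, p d (x d - y d) (x d - y d) <= e) ->
  q x = q y.
Proof.
move=> xb yb xy; apply/eqP; rewrite -subr_eq0 -(dnorm_eq0 (@inner R E)); apply/eqP.
have xyb := ubounded_sub xb yb; rewrite -ultra_q_sub //.
apply: (ultra_cvg_unique U_ultra (q_cvg xyb xyb)).
apply/cvgrPdist_le => e /xy; apply: filterS => d.
by rewrite sub0r normrN ger0_norm // (psd_ge0 (p_psd d)).
Qed.

(** With [H -> F] read as a tensor product, this is [T] (x) 1 at every index. *)
Definition pointwise_op (T : F -> F) (x : D -> H -> F) : D -> H -> F :=
  fun d u => T (x d u).

Lemma pointwise_op_le T (C : R[i]) x d : 0 <= C -> (forall y, `|T y| <= C * `|y|) ->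
  p d (pointwise_op T x d) (pointwise_op T x d) <= C ^+ 2 * p d (x d) (x d).
Proof.
move=> C0 TC; rewrite mulr_sumr; apply: ler_sum => u _.
by rewrite !sqr_normr -exprMn ler_pXn2r ?nnegrE ?mulr_ge0 //; exact: TC.
Qed.

Lemma ubounded_pointwise_op T x : bounded_op T -> ubounded U p x ->
  ubounded U p (pointwise_op T x).
Proof.
move=> /bounded_op_bound[C C0 TC] [M xM]; exists (C * M).
apply: filterS xM => d xM; apply: le_trans (ler_wpM2l C0 xM).
rewrite -(@ler_pXn2r _ 2) ?nnegrE ?mulr_ge0 ?psd_norm_ge0 //.
by rewrite exprMn !sqr_psd_norm pointwise_op_le.
Qed.

(** The estimate holds at every index and passes to the limit. It gives boundedness of [ultra_rep T]
    and also its independence of the chosen lift. *)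
Lemma norm_q_pointwise_op T (C : R[i]) x : bounded_op T -> 0 <= C ->
  (forall y, `|T y| <= C * `|y|) -> ubounded U p x ->
  `|q (pointwise_op T x)| <= C * `|q x|.
Proof.
move=> Tb C0 TC xb; have Txb := ubounded_pointwise_op Tb xb.
rewrite -(@ler_pXn2r _ 2) ?nnegrE ?mulr_ge0 // exprMn -!sqr_normr -subr_ge0.
have h : (fun d => C ^+ 2 * p d (x d) (x d) -
    p d (pointwise_op T x d) (pointwise_op T x d) : R[i]^o) @ U -->
    (C ^+ 2 * inner (q x) (q x) -
     inner (q (pointwise_op T x)) (q (pointwise_op T x)) : R[i]^o).
  apply: cvgB; last exact: q_cvg.
  by apply: cvgM; [exact: cvg_cst|exact: q_cvg].
apply: (ultra_cvg_ge0 U_ultra h); apply: filterE => d.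
by rewrite subr_ge0 pointwise_op_le.
Qed.

Definition ultra_lift (f : E) : D -> H -> F := s2val (cid2 (q_surj f)).

Lemma ultra_lift_bounded f : ubounded U p (ultra_lift f).
Proof. by rewrite /ultra_lift; case: cid2. Qed.

Lemma ultra_liftK f : q (ultra_lift f) = f.
Proof. by rewrite /ultra_lift; case: cid2. Qed.

Definition ultra_rep (T : F -> F) (f : E) : E := q (pointwise_op T (ultra_lift f)).

Lemma ultra_repE T x : bounded_op T -> ubounded U p x ->
  ultra_rep T (q x) = q (pointwise_op T x).
Proof.
move=> Tb xb; have yb := ultra_lift_bounded (q x).
apply/eqP; rewrite -subr_eq0 -ultra_q_sub; do ?exact: ubounded_pointwise_op.
have -> : pointwise_op T (ultra_lift (q x)) - pointwise_op T x =
    pointwise_op T (ultra_lift (q x) - x).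
  apply/funext => d; apply/funext => u.
  by rewrite /pointwise_op (linear_atB _ _ Tb.1).
have [C C0 TC] := bounded_op_bound Tb.
have := norm_q_pointwise_op Tb C0 TC (ubounded_sub yb xb).
by rewrite ultra_q_sub // ultra_liftK subrr normr0 mulr0 normr_le0.
Qed.

Lemma ultra_rep_bounded T : bounded_op T -> bounded_op (ultra_rep T).
Proof.
move=> Tb; have [C C0 TC] := bounded_op_bound Tb.
apply: (bounded_op_intro C0) => [a f g|f].
  have fb := ultra_lift_bounded f; have gb := ultra_lift_bounded g.
  rewrite -(ultra_liftK f) -(ultra_liftK g) -q_linear // !ultra_repE //; last first.
    exact: (ubounded_linear U_ultra p_psd).
  rewrite -q_linear; do ?exact: ubounded_pointwise_op.
  congr q; apply/funext => d; apply/funext => u; exact: Tb.1.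
rewrite -{2}(ultra_liftK f).
exact: norm_q_pointwise_op (ultra_lift_bounded f).
Qed.

(** Composition and adjoint relations already hold index by index, for arbitrary bounded operators
    of [F], and are inherited by the limit. *)
Lemma ultra_star_representation (A : set (F -> F)) : A `<=` @bounded_op R F ->
  star_representation A ultra_rep.
Proof.
move=> Ab.
split=> [T /Ab|a T V /Ab Tb /Ab Vb|T V /Ab Tb /Ab Vb|T V /Ab Tb /Ab Vb TV].
- exact: ultra_rep_bounded.
- apply/funext => f; rewrite -[RHS]/(a *: ultra_rep T f + ultra_rep V f).
  by rewrite -q_linear //; apply: ubounded_pointwise_op => //;
    exact: ultra_lift_bounded.
- apply/funext => f; have fb := ultra_lift_bounded f.
  rewrite /= [ultra_rep V f]/ultra_rep ultra_repE //.
  exact: ubounded_pointwise_op.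
- move=> f g; have fb := ultra_lift_bounded f; have gb := ultra_lift_bounded g.
  have Tfb := ubounded_pointwise_op Tb fb; have Vgb := ubounded_pointwise_op Vb gb.
  have := q_cvg fb Vgb; rewrite ultra_liftK => h1.
  have := q_cvg Tfb gb; rewrite ultra_liftK => h2.
  apply: (ultra_cvg_unique U_ultra h2).
  suff -> : (fun d => p d (pointwise_op T (ultra_lift f) d) (ultra_lift g d)) =
    (fun d => p d (ultra_lift f d) (pointwise_op V (ultra_lift g) d)) by exact: h1.
  by apply/funext => d; apply: eq_bigr => u _; exact: TV.
Qed.

End UltraproductRepresentation.

(** * Sufficiency *)

Section SpanFilter.
Variables (R : realType) (H : hilbertType R).

(** An index consists of a truncation order [k] and a finite family [us]. The vectors to be expanded
    may depend on [k], because those spanning the ranges of the stage [k] operators do. Gram-Schmidt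
    makes the filter proper. *)
Definition span_filter : set_system (nat * seq H) :=
  [set A | exists k0 (l : nat -> seq H), forall k us, (k0 <= k)%N ->
     (forall v, v \in l k -> expands inner us v) -> A (k, us)].

Instance span_filter_proper : ProperFilter span_filter.
Proof.
apply: Build_ProperFilter_ex => [A [k0 [l A_l]]|].
  have [||||us [_ _ usE]] := @gram_schmidt _ _ _ (inner_psd H) setT (l k0) => //.
    by move=> v _ /eqP; rewrite dnorm_eq0 => /eqP.
  by exists (k0, us); apply: A_l.
split=> [|A A' [k0 [l A_l]] [k0' [l' A_l']]|A A' AA' [k0 [l A_l]]].
- by exists 0%N, (fun=> [::]).
- exists (maxn k0 k0'), (fun k => l k ++ l' k) => k us.
  rewrite geq_max => /andP[k0k k0k'] usE; split.
    by apply: A_l => // v vl; apply: usE; rewrite mem_cat vl.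
  by apply: A_l' => // v vl; apply: usE; rewrite mem_cat vl orbT.
- by exists k0, l => k us k0k usE; apply/AA'/A_l.
Qed.

End SpanFilter.

Definition first_codes (T : countType) (k : nat) : seq T :=
  undup (pmap choice.unpickle (iota 0 k)).

Lemma mem_first_codes (T : countType) k (x : T) :
  (choice.pickle x < k)%N -> x \in first_codes T k.
Proof.
move=> xk; rewrite mem_undup mem_pmap -(@choice.pickleK T x) map_f //.
by rewrite mem_iota add0n.
Qed.

Section Sufficiency.
Variables (R : realType) (n : option nat) (Sigma : set (word n)).
Variables (H : hilbertType R) (M : word n -> H).
Hypothesis M_toep : toeplitz Sigma M.
Variables (F : hilbertType R) (vac : F) (S : gen n -> F -> F).
Hypothesis vac_inner : inner vac vac = 1.
Hypothesis S_bounded : forall i, bounded_op (S i).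
Hypothesis S_inner :
  forall i j x y, inner (S i x) (S j y) = (i == j)%:R * inner x y.
Hypothesis S_vac : forall i x, inner (S i x) vac = 0.

Let S_linear i : linear (S i). Proof. exact: (S_bounded i).1. Qed.

Lemma toeplitz_dilation : exists (E : hilbertType R) (J : {linear H -> E})
    (pi : (F -> F) -> (E -> E)), [/\ forall x y, inner (J x) (J y) = inner x y,
    forall A, A `<=` @bounded_op R F -> star_representation A pi,
    pi id = id &
    forall i w, Sigma (i :: w) -> J (M (i :: w)) = pi (S i) (J (M w))].
Proof.
pose g k := first_codes (gen n) k.
have g_uniq k : uniq (g k) by exact: undup_uniq.
have stage k : exists TBs : (gen n -> H -> H) * (gen n -> H -> H) * seq H,
    [/\ partial_isometries TBs.1.1 TBs.1.2,
    forall us x i, i \in g k -> (forall v, v \in TBs.2 -> expands inner us v) ->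
      expands inner us (TBs.1.1 i x) /\ expands inner us (TBs.1.2 i x) &
    forall i w, w \in first_codes (word n) k -> Sigma (i :: w) ->
      TBs.1.1 i (M w) = M (i :: w) /\ TBs.1.2 i (M (i :: w)) = M w].
  have [T [B [s [TB sE MTB]]]] :=
    shift_partial_isometries M_toep (first_codes (word n) k) (g k).
  by exists (T, B, s).
have [TBs stageP] := choice stage.
pose T k := (TBs k).1.1; pose B k := (TBs k).1.2; pose s k := (TBs k).2.
have [U [U_ultra FU]] := ultraFilterLemma (@span_filter_proper R H).
have U_ht m : U [set d | (m <= d.1)%N].
  by apply: FU; exists m, (fun=> [::]).
pose p (d : nat * seq H) := @tensor_form R H F d.2.
have p_psd d : psd_form (p d) by exact: tensor_psd.
have [E [q [q_lin q_cvg q_surj]]] := ultraproduct U_ultra U_ht p_psd.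
(* [fejer] of order [k.+1] multiplies inner products by [k.+1], which [a k] normalizes away; the
   shift by one keeps this factor nonzero. *)
pose a k : R[i] := (sqrtC k.+1%:R)^-1.
have aa k : a k * (a k)^* = k.+1%:R^-1.
  have ar : (a k)^* = a k.
    by rewrite conj_Creal // ger0_real // invr_ge0 sqrtC_ge0.
  by rewrite ar -expr2 exprVn sqrtCK.
pose K x (d : nat * seq H) := a d.1 *: fejer vac S (T d.1) (B d.1) (g d.1) d.1.+1 x.
have good x : U [set d | expands inner d.2 x /\
    forall v, v \in s d.1 -> expands inner d.2 v].
  apply: FU; exists 0%N, (fun k => x :: s k) => k us _ usE; split.
    by apply: usE; rewrite mem_head.
  by move=> v vs; apply: usE; rewrite inE vs orbT.
have K_inner x y : \forall d \near U, p d (K x d) (K y d) = inner x y.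
  apply: filterS (good x) => -[k us] [/= xE sE].
  have [TB usTB _] := stageP k.
  have f_inner := fejer_inner vac_inner S_inner S_vac TB (g_uniq k).
  rewrite /K /= (psdZl (p_psd (k, us))) (psdZr (p_psd (k, us))) mulrA aa.
  rewrite -[p _ _ _]/(tensor_form us _ _) /T /B f_inner //.
    by rewrite mulKf // pnatr_eq0.
  by move=> z i ig; exact: usTB.
have Kb x : ubounded U p (K x).
  exists (sqrtC (inner x x)); apply: filterS (K_inner x x) => d.
  by rewrite /psd_norm => ->.
have J_lin : linear (fun x => q (K x)).
  move=> c x y; rewrite -q_lin //; congr q; apply/funext => -[k us].
  rewrite -[RHS]/(c *: K x (k, us) + K y (k, us)) /K /=.
  have [TB _ _] := stageP k.
  by rewrite (fejer_linear vac S_linear (g k) TB) scalerDr !scalerA mulrC.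
pose J : {linear H -> E} := HB.pack (fun x => q (K x))
  (GRing.isLinear.Build _ _ _ _ (fun x => q (K x)) J_lin).
exists E, J, (ultra_rep q_surj); split.
- move=> x y; apply: (ultra_cvg_unique U_ultra (q_cvg _ _ (Kb x) (Kb y))).
  have c : (fun=> inner x y : R[i]^o) @ U --> (inner x y : R[i]^o) by exact: cvg_cst.
  apply: cvg_trans c; apply: near_eq_cvg.
  by apply: filterS (K_inner x y) => d ->.
- move=> A; exact: (ultra_star_representation U_ultra q_lin q_cvg).
- by apply/funext => f; rewrite -[RHS](ultra_liftK q_surj).
- move=> i w iw; rewrite /= (ultra_repE U_ultra q_lin q_cvg) //.
  apply: (ultra_q_eq U_ultra q_lin q_cvg) => //.
    exact: (ubounded_pointwise_op U_ultra).
  move=> e e0.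
  (* The summand 1 keeps the divisor positive when [M w = 0]. *)
  have c0 : 0 < 2 * inner (M w) (M w) + 1.
    by rewrite ltr_wpDl // mulr_ge0 // (psd_ge0 (inner_psd H)).
  have [N NP] := complex_archi (divr_gt0 e0 c0).
  have U_filter : Filter U by exact: _.
  (* Beyond these thresholds [i] and [w] belong to the truncation, and the factor [1 / (k + 1)] is
     at most [2 ^- N]. *)
  have near_d := @filterI _ U U_filter _ _ (good (M w))
    (U_ht (maxn (maxn (choice.pickle i).+1 (choice.pickle w).+1) (2 ^ N))).
  apply: (@filterS _ U U_filter _ _ _ near_d) => -[k us] [/= [wE sE]].
  rewrite !geq_max => /andP[/andP[ik wk] Nk].
  have [TB usTB MTB] := stageP k.
  have ig : i \in g k by exact: mem_first_codes.
  have [TM BM] := MTB i w (mem_first_codes wk) iw.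
  (* Now [BM] says that [M w] lies in the initial space of [T k i], as the intertwining estimate
     requires. *)
  rewrite -TM in BM.
  have -> : K (M (i :: w)) (k, us) - pointwise_op (S i) (K (M w)) (k, us) =
      a k *: (fejer vac S (T k) (B k) (g k) k.+1 (T k i (M w)) -
        (S i \o fejer vac S (T k) (B k) (g k) k.+1 (M w))).
    apply/funext => u; pose f z := fejer vac S (T k) (B k) (g k) k.+1 z u.
    rewrite -[LHS]/(a k *: f (M (i :: w)) - S i (a k *: f (M w))).
    rewrite -[RHS]/(a k *: (f (T k i (M w)) - S i (f (M w)))).
    by rewrite (linear_atZ _ _ (S_linear i)) /T TM scalerBr.
  rewrite -[tensor_form _ _ _]/(p (k, us) _ _).
  rewrite (psdZl (p_psd (k, us))) (psdZr (p_psd (k, us))) mulrA aa.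
  have := fejer_intertwining vac_inner S_linear S_inner S_vac TB (g_uniq k)
    (fun z j jg => usTB us z j jg sE) k ig BM wE.
  move=> /(ler_wpM2l (_ : 0 <= k.+1%:R^-1))/le_trans; apply.
    by rewrite invr_ge0.
  have kN : k.+1%:R^-1 <= 2 ^- N :> R[i].
    rewrite lef_pV2 ?posrE ?ltr0n ?exprn_gt0 // -natrX ler_nat.
    exact: leq_trans Nk (leqnSn k).
  have kd := le_trans kN (ltW (NP N (leqnn N))).
  rewrite (le_trans (ler_wpM2r _ kd)) ?mulr_ge0 ?(psd_ge0 (inner_psd H)) //.
  rewrite mulrAC ler_pdivrMr // ler_wpM2l ?(ltW e0) // lerDl.
  exact: ler01.
Qed.

End Sufficiency.

Theorem theorem2p6 (R : realType) (n : option nat) (n_gt0 : n <> Some 0%N)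
  (Hn : hilbertType R) (e : gen n -> Hn) (e_basis : orthonormal_basis e)
  (F : hilbertType R) (tens : seq Hn -> F) (F_fock : full_fock_space tens)
  (S : gen n -> F -> F) (S_creation : forall i, left_creation tens (e i) (S i))
  (Sigma : set (word n)) (Sigma_adm : admissible Sigma)
  (H : hilbertType R) (M : word n -> H) :
  (exists (E : hilbertType R) (J : {linear H -> E})
      (pi : (F -> F) -> (E -> E)),
    [/\ forall x y, inner (J x) (J y) = inner x y,
        star_representation (cstar_generated S) pi &
        forall p, polynomials Sigma p ->
          J (linear_extension M p) =
          pi (linear_extension (word_prod S) p) (J (M [::]))])
  <->
  (forall x y, Lambda Sigma x -> Lambda Sigma y -> K3 M x y = K4 M x y).
Proof.
have S_bounded := creation_bounded S_creation.
have Sigma_tail i w : Sigma (i :: w) -> Sigma w by exact: (Sigma_adm [:: i] w).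
apply: iff_trans (iff_sym (kernels_toeplitz Sigma_adm M)).
split=> [[E [J [pi [J_inner pi_rep J_pi]]]] i j w v iw jv|M_toep].
  have JM u : Sigma u -> J (M u) = pi (word_prod S u) (J (M [::])).
    move=> uS; have [p p_supp pE] := indicator_polynomial R u.
    by rewrite -!pE; apply: J_pi => x /p_supp ->.
  rewrite -(J_inner (M (i :: w))) -(J_inner (M w)) (JM _ iw) (JM _ jv).
  rewrite (JM _ (Sigma_tail _ _ iw)) (JM _ (Sigma_tail _ _ jv)).
  exact: (dilation_toeplitz n_gt0 e_basis F_fock S_creation _ pi_rep).
have [E [J [pi [J_inner pi_rep pi_id J_pi]]]] := toeplitz_dilation M_toep
  (vacuum_inner F_fock) S_bounded (creation_inner e_basis F_fock S_creation)
  (creation_vacuum e_basis F_fock S_creation).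
exists E, J, pi; split=> //.
  exact/pi_rep/cstar_generated_bounded.
(* [pi] represents all bounded operators of [F]; these include the identity and every
   [word_prod S u], so the computation is carried out among them. *)
have B_rep := pi_rep _ (@subset_refl _ (@bounded_op R F)).
have B_alg := bounded_op_cstar F.
have wB u : bounded_op (word_prod S u).
  elim: u => [|i u IH] /=; last exact: (cstar_comp B_alg (S_bounded i) IH).
  by split=> // x.
have JM u : Sigma u -> J (M u) = pi (word_prod S u) (J (M [::])).
  (* Removing the first letter stays in [Sigma] by admissibility; the empty word uses that this [pi]
     is unital. *)
  elim: u => [|i u IH] iu; first by rewrite /= pi_id.
  rewrite J_pi // IH; last exact: Sigma_tail iu.
  by rewrite /= (star_rep_comp B_rep (S_bounded i) (wB u)).
move=> p pS; rewrite /linear_extension linear_sum.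
rewrite (star_rep_sum _ _ B_alg B_rep wB) fct_sumE.
apply: eq_big_seq => w /pS wS.
by rewrite linearZ /= JM.
Qed.
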